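(* Let $(K,\nu)$ be a valued field that is either henselian or of rank one, and let $\omega$ be a valuation transcendental extension of $\nu$ to $K(x)$ such that $\nu K$ is cofinal in $\omega K(x)$. Take a minimal pair of definition $(a,\gamma)$ for $\omega$ such that $a$ is separable over $K$ and $a\notin K$. Then $$IC(K(x)|K,\omega)=K(a)^h\quad\text{if and only if}\quad\gamma>\mathrm{kras}(a,K).$$
   Context: Values are written additively, $\nu 0=\infty$; for a valued field $(L,\nu)$, $\nu L$ and $L\nu$ denote the value group and residue field. $(K,\nu)$ has rank one if $\nu K$ is (isomorphic to) a nontrivial ordered subgroup of $\mathbb{R}$. $\overline{K}$ is a fixed algebraic closure of $K$. An extension $\omega$ of $\nu$ to the rational function field $K(x)$ is value transcendental if $\dim_{\mathbb{Q}}\big((\omega K(x)/\nu K)\otimes_{\mathbb{Z}}\mathbb{Q}\big)=1$, residue transcendental if $\mathrm{trdeg}[K(x)\omega:K\nu]=1$, and valuation transcendental if it is one of these. Fix an extension $\overline{\nu}$ of $\nu$ to $\overline{K}$ and a common extension $\overline{\omega}$ of $\omega$ and $\overline{\nu}$ to $\overline{K}(x)$; also fix an extension of $\overline{\omega}$ to an algebraic closure $\overline{K(x)}$ of $\overline{K}(x)$. For $a\in\overline{K}$ and $\gamma$ in an ordered abelian group containing $\overline{\nu}\,\overline{K}$, $\overline{\nu}_{a,\gamma}$ is the valuation on $\overline{K}(x)$ determined by $\overline{\nu}_{a,\gamma}\big(\sum_i c_i(x-a)^i\big)=\min_i\{\overline{\nu}c_i+i\gamma\}$ ($c_i\in\overline{K}$).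 A pair $(a,\gamma)$ with $a\in\overline{K}$, $\gamma\in\overline{\omega}\,\overline{K}(x)$ is a pair of definition for $\omega$ if $\overline{\omega}=\overline{\nu}_{a,\gamma}$; it is a minimal pair of definition if moreover for every $b\in\overline{K}$, $\overline{\nu}(a-b)\geq\gamma$ implies $[K(a):K]\leq[K(b):K]$. For $a\in\overline{K}\setminus K$ not purely inseparable over $K$, $\mathrm{kras}(a,K):=\max\{\overline{\nu}(\sigma a-\tau a)\mid\sigma,\tau\in\mathrm{Gal}(\overline{K}|K),\ \sigma a\neq\tau a\}$. For $L|K$ algebraic, $L\subseteq\overline{K}$, $L^h$ is the henselization of $L$ inside $\overline{K}$ with respect to $\overline{\nu}$; $K(x)^h$ is the henselization of $(K(x),\omega)$ inside $\overline{K(x)}$ with respect to the fixed extension of $\overline{\omega}$; and $IC(K(x)|K,\omega):=\overline{K}\cap K(x)^h$. *)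

(* Defs.v *)
From HB Require Import structures.
From mathcomp Require Import all_boot all_order all_algebra all_field.
From mathcomp Require Import generic_quotient ring_quotient.
From mathcomp Require Import boolp classical_sets reals.

Set Implicit Arguments.
Unset Strict Implicit.
Unset Printing Implicit Defensive.
Import Order.TTheory GRing.Theory Num.Theory.
Local Open Scope classical_set_scope.
Local Open Scope ring_scope.

(* The order class [Order.Total] is not used here because a new structure over
   both [Order.Total] and [Zmodule] would miss a join with [realDomainType]. *)
HB.mixin Record isOrderedZmodule G of Num.POrderedZmodule G := {
  oag_le_total : forall x y : G, (x <= y) || (y <= x);
  oag_leD2l : forall z x y : G, x <= y -> z + x <= z + y
}.

#[short(type="orderedZmodType")]
HB.structure Definition OrderedZmodule :=
  { G of Num.POrderedZmodule G & isOrderedZmodule G }.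

(* Values lie in [option G]; [None] is the value infinity. *)
Section ExtendedValues.
Variable G : orderedZmodType.
Implicit Types s t : option G.

Definition addv s t : option G :=
  if (s, t) is (Some g, Some h) then Some (g + h) else None.

Definition lev s t : bool :=
  match s, t with
  | _, None => true
  | None, Some _ => false
  | Some g, Some h => g <= h
  end.

Definition minv s t : option G := if lev s t then s else t.

End ExtendedValues.

Record valuation (L : fieldType) (G : orderedZmodType) := Valuation {
  vfun :> L -> option G;
  vfun_eqoo : forall z, vfun z = None <-> z = 0;
  vfunM : forall z w, vfun (z * w) = addv (vfun z) (vfun w);
  vfunD : forall z w, lev (minv (vfun z) (vfun w)) (vfun (z + w))
}.

Definition value_group (L : fieldType) (G : orderedZmodType)
    (v : valuation L G) : set G := [set g | exists z, v z = Some g].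

Definition extends_valuation (L M : fieldType) (G : orderedZmodType)
    (i : L -> M) (v : valuation L G) (w : valuation M G) : Prop :=
  forall z, w (i z) = v z.

Definition rank_one (R : realType) (L : fieldType) (G : orderedZmodType)
    (v : valuation L G) : Prop :=
  (exists2 g, value_group v g & g != 0) /\
  exists f : G -> R, forall g h, value_group v g -> value_group v h ->
    f (g + h) = f g + f h /\ (g < h -> f g < f h).

Section ResidueField.
Variables (L : fieldType) (G : orderedZmodType) (v : valuation L G).

Lemma oag_leD2r (z x y : G) : x <= y -> x + z <= y + z.
Proof. by rewrite ![_ + z]addrC; apply: oag_leD2l. Qed.

Lemma oag_addr_ge0 (x y : G) : 0 <= x -> 0 <= y -> 0 <= x + y.
Proof.
move=> x0 y0; apply: (le_trans x0); rewrite -[leLHS]addr0.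
exact: oag_leD2l.
Qed.

Lemma oag_double_eq0 (x : G) : x + x = 0 -> x = 0.
Proof.
move=> xx0; have [x0|x0] := orP (oag_le_total 0 x); apply/eqP; rewrite eq_le x0.
  by have := @oag_leD2l G x _ _ x0; rewrite addr0 xx0 => ->.
by have := @oag_leD2l G x _ _ x0; rewrite addr0 xx0 => ->.
Qed.

Lemma oag_ltNge (x y : G) : (x < y) = ~~ (y <= x).
Proof.
apply/idP/idP => [xy|yx]; first by apply/negP => /(lt_le_trans xy); rewrite ltxx.
rewrite lt_neqAle; have := oag_le_total x y; rewrite (negPf yx) orbF => xy.
by rewrite xy andbT; apply: contraNneq yx => ->.
Qed.

Lemma vfun1 : v 1 = Some 0.
Proof.
have := vfunM v 1 1; rewrite mulr1.
case E: (v 1) => [g|] /=; last by have/eqP := (vfun_eqoo v 1).1 E; rewrite oner_eq0.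
by case=> /eqP; rewrite -[X in X == _]addr0 (inj_eq (addrI _)) => /eqP <-.
Qed.

Lemma vfun0 : v 0 = None. Proof. exact/vfun_eqoo. Qed.

Lemma vfunN z : v (- z) = v z.
Proof.
rewrite -mulN1r vfunM; suff -> : v (-1) = Some 0.
  by case: (v z) => //= g; rewrite /addv add0r.
have := vfunM v (-1) (-1); rewrite mulrNN mulr1 vfun1.
by case: (v (-1)) => //= g [/esym/oag_double_eq0 ->].
Qed.

Lemma lev_trans (s t u : option G) : lev s t -> lev t u -> lev s u.
Proof. by case: s t u => [g|] [h|] [k|] //=; exact: le_trans. Qed.

Lemma ltv_le_trans (s t u : option G) : ~~ lev t s -> lev t u -> ~~ lev u s.
Proof. by move=> ts tu; apply: contra ts; exact: lev_trans. Qed.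

Definition valuation_ring : {pred L} := [pred z | lev (Some 0) (v z)].

Lemma valuation_ring_subring : subring_closed valuation_ring.
Proof.
have inV z : (z \in valuation_ring) = lev (Some 0) (v z) by [].
split=> [|x y|x y]; rewrite !inV; first by rewrite vfun1 /= lexx.
  move=> vx vy; apply: (lev_trans _ (vfunD v x (- y))).
  by rewrite vfunN /minv; case: ifP.
rewrite vfunM; case: (v x) => [g|]; case: (v y) => [h|] //=.
by move=> *; exact: oag_addr_ge0.
Qed.

HB.instance Definition _ :=
  GRing.isSubringClosed.Build L valuation_ring valuation_ring_subring.

Record valuation_ringT :=
  ValuationRing { vr_val :> L; _ : vr_val \in valuation_ring }.
HB.instance Definition _ := [isSub for vr_val].
HB.instance Definition _ := [Choice of valuation_ringT by <:].
HB.instance Definition _ :=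
  [SubChoice_isSubComNzRing of valuation_ringT by <:].

Definition maximal_ideal : {pred valuation_ringT} :=
  [pred z | ~~ lev (v (vr_val z)) (Some 0)].

Lemma vr_ge0 (z : valuation_ringT) : lev (Some 0) (v (vr_val z)).
Proof. by case: z. Qed.

Lemma maximal_ideal_idealr : idealr_closed maximal_ideal.
Proof.
have inM z : (z \in maximal_ideal) = ~~ lev (v (vr_val z)) (Some 0) by [].
split; rewrite ?inM /= ?vfun0 ?vfun1 /= ?lexx //.
move=> a x y; rewrite !inM [vr_val (a * x + y)]/(vr_val a * vr_val x + vr_val y); set ax := vr_val a * vr_val x.
have ax0 : ~~ lev (v (vr_val x)) (Some 0) -> ~~ lev (v ax) (Some 0).
  rewrite /ax vfunM; have := vr_ge0 a.
  case: (v (vr_val a)) => [g|]; case: (v (vr_val x)) => [h|] //= g0.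
  rewrite -!oag_ltNge => h0; apply: lt_le_trans h0 _.
  by rewrite -[leLHS]add0r; exact: oag_leD2r.
move=> /ax0 {}ax0 y0; apply: (ltv_le_trans _ (vfunD v ax (vr_val y))).
by rewrite /minv; case: ifP.
Qed.

HB.instance Definition _ :=
  isIdealr.Build valuation_ringT maximal_ideal maximal_ideal_idealr.

Definition residue_field := {ideal_quot maximal_ideal}.
HB.instance Definition _ := GRing.ComNzRing.on residue_field.
HB.instance Definition _ := NzRingQuotient.on residue_field.

Definition vr_inv (z : valuation_ringT) : valuation_ringT :=
  if z \in maximal_ideal then 0 else insubd 0 (vr_val z)^-1.

Definition residue_inv (r : residue_field) : residue_field :=
  \pi_residue_field%qT (vr_inv (repr r)).

Lemma pi_residueE (z : valuation_ringT) :
  (\pi_residue_field z == 0)%qT = (z \in maximal_ideal).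
Proof.
rewrite -[z in RHS]subr0 Quotient.idealrBE.
by rewrite -(rmorph0 \pi_residue_field%qT).
Qed.

Lemma vr_inv_proof (z : valuation_ringT) :
  z \notin maximal_ideal -> (vr_val z)^-1 \in valuation_ring.
Proof.
have -> : (z \notin maximal_ideal) = lev (v (vr_val z)) (Some 0) by rewrite -[RHS]negbK.
move=> z0; have -> : ((vr_val z)^-1 \in valuation_ring)
  = lev (Some 0) (v (vr_val z)^-1) by [].
have zN : vr_val z != 0 by apply/eqP => zE; move: z0; rewrite zE vfun0.
have := vfunM v (vr_val z) (vr_val z)^-1; rewrite mulfV // vfun1.
case: (v (vr_val z)) z0 => [g|]; case: (v _^-1) => [h|] //= g0 [gh].
by rewrite gh -[leRHS]add0r; exact: oag_leD2r.
Qed.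

Lemma residue_mulV (r : residue_field) : r != 0 -> residue_inv r * r = 1.
Proof.
rewrite /residue_inv -[r in r != 0]reprK pi_residueE /vr_inv => rN.
rewrite (negPf rN) -[r in _ * r]reprK -rmorphM -[RHS](rmorph1 \pi_residue_field%qT).
congr (\pi_residue_field%qT _); apply: val_inj.
have rV := vr_inv_proof rN.
rewrite [LHS](_ : _ = vr_val (insubd 0 (vr_val (repr r))^-1) * vr_val (repr r)) //.
rewrite [vr_val _](insubdK _ rV) mulVf //.
apply/eqP => rE; move: rN.
suff -> : repr r = 0 by rewrite -pi_residueE rmorph0 eqxx.
exact: val_inj.
Qed.

Lemma residue_inv0 : residue_inv 0 = 0.
Proof.
rewrite /residue_inv /vr_inv; have -> : repr (0 : residue_field) \in maximal_ideal.
  by rewrite -pi_residueE reprK.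
exact: rmorph0.
Qed.

HB.instance Definition _ :=
  GRing.ComNzRing_isField.Build residue_field residue_mulV residue_inv0.

(* The residue of [z]; junk (the residue of 0) outside the valuation ring. *)
Definition residue (z : L) : residue_field := \pi_residue_field%qT (insubd 0 z).

End ResidueField.

Section Subfields.
Variable L : fieldType.
Implicit Types (F E : set L) (z : L).

Definition is_subfield F : Prop :=
  [/\ F 1, forall y z, F y -> F z -> F (y - z)
         & forall y z, F y -> F z -> F (y / z)].

Definition adjoin F z : set L :=
  \bigcap_(E in [set E | [/\ is_subfield E, F `<=` E & E z]]) E.

Definition algebraic_over F z : Prop :=
  exists p : {poly L}, [/\ p != 0, forall i, F p`_i & root p z].

(* [E] has an F-basis indexed by ['I_n]. *)
Definition has_degree E F (n : nat) : Prop :=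
  exists e : 'I_n -> L, (forall i, E (e i)) /\
    forall z, E z -> exists! c : {ffun 'I_n -> L},
      (forall i, F (c i)) /\ z = \sum_(i < n) c i * e i.

(* [E : F]; 0 when it is infinite. *)
Definition degree E F : nat := xget 0%N [set n | has_degree E F n].

(* [L] has transcendence degree 1 over [F]: a transcendence basis {t}. *)
Definition trdeg_eq1 F : Prop :=
  exists t, ~ algebraic_over F t /\ forall z, algebraic_over (adjoin F t) z.

End Subfields.

Section AlgebraicClosure.
Variables (K : fieldType) (Kbar : closedFieldType) (iota : {rmorphism K -> Kbar}).

Definition is_algebraic_closure : Prop := forall z, algebraicOver iota z.

Definition in_galois (s : {rmorphism Kbar -> Kbar}) : Prop :=
  bijective s /\ forall c, s (iota c) = iota c.

Definition is_minpoly (a : Kbar) (p : {poly K}) : Prop :=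
  [/\ p \is monic, irreducible_poly p & root (map_poly iota p) a].

Definition separable_over (a : Kbar) : Prop :=
  exists2 p, is_minpoly a p & separable_poly p.

End AlgebraicClosure.

Definition frac_const (F : fieldType) (c : F) : {fraction {poly F}} :=
  FracField.tofrac c%:P.

Section FractionMap.
Variables (F E : fieldType) (f : {rmorphism F -> E}).

Definition frac_map (z : {fraction {poly F}}) : {fraction {poly E}} :=
  FracField.tofrac (map_poly f (\n_(repr z))) /
  FracField.tofrac (map_poly f (\d_(repr z))).

Lemma repr_fracE (z : {fraction {poly F}}) :
  z * FracField.tofrac (\d_(repr z)) = FracField.tofrac (\n_(repr z)).
Proof.
rewrite -{1}[z]reprK; set x := repr z; unlock FracField.tofrac.
rewrite -[LHS]FracField.pi_mul; apply/eqmodP.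
rewrite /= FracField.equivfE /FracField.mulf !numden_Ratio ?mulr1 ?oner_eq0 //.
  by rewrite mulrC.
all: exact: denom_ratioP.
Qed.

Lemma frac_mapE (p q : {poly F}) : q != 0 ->
  frac_map (FracField.tofrac p / FracField.tofrac q) =
  FracField.tofrac (map_poly f p) / FracField.tofrac (map_poly f q).
Proof.
move=> q0; have tq0 (E' : fieldType) (r : {poly E'}) : r != 0 ->
  FracField.tofrac r != 0 by rewrite tofrac_eq0.
set z := _ / _; have d0 : \d_(repr z) != 0 by exact: denom_ratioP.
rewrite /frac_map; apply/eqP; rewrite eqr_div ?tq0 ?map_poly_eq0 //.
rewrite -!tofracM -!rmorphM tofrac_eq; apply/eqP; congr (map_poly f _).
apply/eqP; rewrite -tofrac_eq !tofracM -repr_fracE mulrAC.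
by rewrite {1}/z divfK ?tq0.
Qed.

End FractionMap.

Section RationalFunctionField.
Variables (G : orderedZmodType).

(* A map on the subgroup [A] which is additive and kills the subgroup [B]. *)
Definition additive_mod (A B : set G) (W : zmodType) (t : G -> W) : Prop :=
  (forall g h, A g -> A h -> t (g + h) = t g + t h) /\
  (forall g, B g -> t g = 0).

(* [V], with [t g] in the role of (g mod B) (x) 1, is the tensor product
   (A/B) (x)_Z Q, by its universal property (extension of scalars). *)
Definition is_quotient_tensorQ (A B : set G) (V : lmodType rat) (t : G -> V)
    : Prop :=
  additive_mod A B t /\
  forall (W : lmodType rat) (u : G -> W), additive_mod A B u ->
    exists h : {linear V -> W}, (forall g, A g -> h (t g) = u g) /\
      forall h' : {linear V -> W}, (forall g, A g -> h' (t g) = u g) -> h' =1 h.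

Section OverK.
Variables (K : fieldType) (nu : valuation K G).
Variable omega : valuation {fraction {poly K}} G.

Definition value_transcendental : Prop :=
  exists (V : vectType rat) (t : G -> V),
    is_quotient_tensorQ (value_group omega) (value_group nu) t /\
    \dim {:V} = 1%N.

(* K\nu, seen inside K(x)\omega. *)
Definition base_residue_field : set (residue_field omega) :=
  [set residue omega (frac_const c) | c in [set c | c \in valuation_ring nu]].

Definition residue_transcendental : Prop := trdeg_eq1 base_residue_field.

Definition valuation_transcendental : Prop :=
  value_transcendental \/ residue_transcendental.

Definition cofinal_values : Prop :=
  forall g, value_group omega g -> exists2 h, value_group nu h & g <= h.

End OverK.

Section OverKbar.
Variables (K : fieldType) (Kbar : closedFieldType) (iota : {rmorphism K -> Kbar}).
Variable nubar : valuation Kbar G.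
Variable omegabar : valuation {fraction {poly Kbar}} G.

(* omegabar = nubar_{a,gamma}; the polynomial \sum_i c_i (x - a)^i is
   [c \Po ('X - a%:P)], and a valuation of Kbar(x) is determined by its values
   on polynomials. *)
Definition is_monomial_valuation (a : Kbar) (gamma : G) : Prop :=
  forall c : {poly Kbar},
    omegabar (FracField.tofrac (c \Po ('X - a%:P))) =
    \big[@minv G/None]_(i < size c) addv (nubar c`_i) (Some (gamma *+ i)).

Definition pair_of_definition (a : Kbar) (gamma : G) : Prop :=
  value_group omegabar gamma /\ is_monomial_valuation a gamma.

Definition minimal_pair_of_definition (a : Kbar) (gamma : G) : Prop :=
  pair_of_definition a gamma /\
  forall b, lev (Some gamma) (nubar (a - b)) ->
    (degree (adjoin (range iota) a) (range iota)
       <= degree (adjoin (range iota) b) (range iota))%N.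

Definition is_kras (a : Kbar) (g : G) : Prop :=
  (exists s t : {rmorphism Kbar -> Kbar},
     [/\ in_galois iota s, in_galois iota t & nubar (s a - t a) = Some g]) /\
  (forall s t : {rmorphism Kbar -> Kbar},
     in_galois iota s -> in_galois iota t -> s a <> t a ->
     lev (nubar (s a - t a)) (Some g)).

Definition kras (a : Kbar) : G := xget 0 [set g | is_kras a g].

End OverKbar.
End RationalFunctionField.

Section Henselization.
(* [L] plays the role of an algebraic closure of the subfields considered. *)
Variables (L : closedFieldType) (G : orderedZmodType) (w : valuation L G).

(* (F, w|F) is henselian: w is the only extension of w|F to the algebraic
   closure [L] of [F]. As w L is a divisible hull of w F, every extension of
   w|F to [L] is equivalent to exactly one with values in the group w L. *)
Definition henselian (F : set L) : Prop :=
  forall w' : valuation L G, (forall z, F z -> w' z = w z) -> w' =1 w.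

(* The smallest henselian subfield of (L, w) containing [F]. *)
Definition henselization (F : set L) : set L :=
  \bigcap_(H in [set H | [/\ is_subfield H, F `<=` H & henselian H]]) H.

End Henselization.

(* IC(K(x)|K, omega) = Kbar \cap K(x)^h, as a subset of Kbar: the intersection
   is taken in the algebraic closure [Omega] of Kbar(x), through [j]. *)
Definition implicit_constant_field (K : fieldType) (Kbar Omega : closedFieldType)
    (G : orderedZmodType) (iota : {rmorphism K -> Kbar})
    (j : {rmorphism {fraction {poly Kbar}} -> Omega}) (W : valuation Omega G)
    : set Kbar :=
  [set z | henselization W (range (j \o frac_map iota)) (j (frac_const z))].

(* Main.v *)
(** A K-automorphism s of Kbar which preserves nubar and moves a by at least
    gamma preserves the monomial valuation omegabar on Kbar(x).  By the
    conjugacy of extensions it lifts to an isometric automorphism of the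
    algebraic closure Omega of Kbar(x), whose fixed field is henselian; hence
    every element of IC is fixed by s.  Applied over a henselian field
    containing K(a), this bounds IC by K(a)^h up to purely inseparable elements,
    which are excluded by a maximal subfield avoiding a p-th root.  Conversely
    gamma > kras puts a in K(x)^h by Krasner's argument applied to x - a.  If
    gamma <= kras, some K-conjugate of a is at distance at least gamma from a;
    it is the image of a under an isometric automorphism, so a is not in IC.
    In rank one, the isometry comes from the minimality of (a, gamma):
    otherwise the minimal polynomial of a would have, over K^h, a proper factor
    which can be approximated over K, giving an element of smaller degree near
    a. *)

From Pilot Require Import Defs.
From HB Require Import structures.
From mathcomp Require Import all_boot all_order all_algebra all_field.
From mathcomp Require Import generic_quotient.
From mathcomp Require Import boolp classical_sets reals.
(* Imported again because [addv] also names an operation of mathcomp's vector. *)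
Import Pilot.Defs.

Set Implicit Arguments.
Unset Strict Implicit.
Unset Printing Implicit Defensive.
Import Order.TTheory GRing.Theory Num.Theory.
Local Open Scope classical_set_scope.
Local Open Scope ring_scope.

(** All automorphisms come from extending partial isometries of an algebraically closed field, one
    algebraic element at a time. The crux is to find, among the roots of the transported minimal
    polynomial, one with the right values; Gauss valuations of a characteristic polynomial defined
    over the base decide this.

    A henselization is an intersection here, so each inclusion is tested against an arbitrary
    henselian field [H] containing the base. Henselianity is uniqueness of the valuation above, and
    it is obtained by reading the values of roots off coefficients: if all roots of a polynomial
    have the same value, its coefficients determine that value.

    In rank one a K-automorphism need not preserve [nubar]. The approximation that repairs this uses
    powers of elements of positive value, which pass any value of Kbar; [gamma] is only a value of
    Kbar(x), and cofinality puts it below a value of K. Since [kras] is a maximum over pairs of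
    automorphisms, both members of a pair are replaced by isometries before they are combined into
    one that moves [a] by exactly [kras]. *)

(** * Ordered abelian groups *)

Section OrderedGroup.
Variable G : orderedZmodType.
Implicit Types x y z t : G.

Lemma oag_lerD x y z t : x <= y -> z <= t -> x + z <= y + t.
Proof.
by move=> xy zt; apply: le_trans (oag_leD2r z xy) _; exact: oag_leD2l.
Qed.

Lemma oag_leD2lE z x y : (z + x <= z + y) = (x <= y).
Proof.
apply/idP/idP => [|xy]; last exact: oag_leD2l.
by move/(oag_leD2l (- z) _ _); rewrite !addKr.
Qed.

Lemma oag_ltD2lE z x y : (z + x < z + y) = (x < y).
Proof. by rewrite !oag_ltNge oag_leD2lE. Qed.

Lemma oag_ltr_leD x y z t : x < y -> z <= t -> x + z < y + t.
Proof.
move=> xy zt; apply: lt_le_trans (oag_leD2l y _ _ zt).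
by rewrite ![_ + z]addrC oag_ltD2lE.
Qed.

Lemma oag_ler_ltD x y z t : x <= y -> z < t -> x + z < y + t.
Proof. by rewrite [x + z]addrC [y + t]addrC => ? ?; exact: oag_ltr_leD. Qed.

Lemma oag_leNgt x y : (x <= y) = ~~ (y < x).
Proof. by rewrite oag_ltNge negbK. Qed.

Lemma oag_lerMn n x y : x <= y -> x *+ n <= y *+ n.
Proof.
by move=> xy; elim: n => [|n IHn] //; rewrite !mulrS; exact: oag_lerD.
Qed.

Lemma oag_ltrMn n x y : (0 < n)%N -> x < y -> x *+ n < y *+ n.
Proof.
case: n => // n _ xy; rewrite !mulrS.
by apply: oag_ltr_leD => //; exact/oag_lerMn/ltW.
Qed.

Lemma oag_lerMnE n x y : (0 < n)%N -> (x *+ n <= y *+ n) = (x <= y).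
Proof.
move=> n0; apply/idP/idP => [|xy]; last exact: oag_lerMn.
by rewrite !oag_leNgt; apply: contra; exact: oag_ltrMn.
Qed.

Lemma oag_mulrIn n : (0 < n)%N -> injective (fun x => x *+ n).
Proof.
move=> n0 x y /= xy; apply/eqP.
by rewrite eq_le -[x <= y](oag_lerMnE _ _ n0) -[y <= x](oag_lerMnE _ _ n0) xy lexx.
Qed.

Lemma oag_oppr_gt0 x : (0 < - x) = (x < 0).
Proof. by rewrite -(oag_ltD2lE x 0) subrr addr0. Qed.

Lemma oag_lt_subr x y : (0 < y - x) = (x < y).
Proof. by rewrite -(oag_ltD2lE x 0) addr0 addrCA subrr addr0. Qed.

Lemma oag_ler_addr x y : 0 <= y -> x <= x + y.
Proof. by move=> y0; have := oag_leD2l x _ _ y0; rewrite addr0. Qed.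

Lemma oag_mulrn_ge0 n x : 0 <= x -> 0 <= x *+ n.
Proof. by move/(oag_lerMn n); rewrite mul0rn. Qed.

Lemma oag_ler_mulrn n x : (0 < n)%N -> 0 <= x -> x <= x *+ n.
Proof.
by case: n => // n _ x0; rewrite mulrS; exact/oag_ler_addr/oag_mulrn_ge0.
Qed.

End OrderedGroup.

(** * Arithmetic and order of values with infinity *)

Section ExtendedValueTheory.
Variable G : orderedZmodType.
Implicit Types s t u : option G.

Lemma addvA : associative (@addv G).
Proof. by case=> [g|] [h|] [k|] //=; rewrite /addv addrA. Qed.

Lemma addvC : commutative (@addv G).
Proof. by case=> [g|] [h|] //=; rewrite /addv addrC. Qed.

Lemma add0v : left_id (Some 0) (@addv G).
Proof. by case=> [g|] //=; rewrite /addv add0r. Qed.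

HB.instance Definition _ :=
  Monoid.isComLaw.Build (option G) (Some 0) (@addv G) addvA addvC add0v.

Lemma addv0 : right_id (Some 0) (@addv G). Proof. exact: Monoid.mulm1. Qed.

Lemma addvoo s : addv s None = None. Proof. by case: s. Qed.

Lemma levv s : lev s s. Proof. by case: s => /=. Qed.

Lemma lev_total s t : lev s t || lev t s.
Proof. by case: s t => [g|] [h|] //=; exact: oag_le_total. Qed.

Lemma levoo s : lev s None. Proof. by case: s. Qed.

Lemma lev_anti s t : lev s t -> lev t s -> s = t.
Proof.
by case: s t => [g|] [h|] //= gh hg; congr Some; apply/eqP; rewrite eq_le gh.
Qed.

Definition ltv s t := ~~ lev t s.

Lemma ltv_lev s t : ltv s t -> lev s t.
Proof. by rewrite /ltv; have := lev_total s t; case: (lev t s); rewrite ?orbF. Qed.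

Lemma ltv_lev_trans s t u : ltv s t -> lev t u -> ltv s u.
Proof. exact: ltv_le_trans. Qed.

Lemma lev_ltv_trans s t u : lev s t -> ltv t u -> ltv s u.
Proof. by move=> st; apply: contra => us; exact: lev_trans st. Qed.

Lemma lev_addv s t u v : lev s t -> lev u v -> lev (addv s u) (addv t v).
Proof.
case: s t u v => [g|] [h|] [k|] [l|] //=; rewrite /lev /addv; exact: oag_lerD.
Qed.

Lemma ltv_addl (g : G) s t : ltv (addv (Some g) s) (addv (Some g) t) = ltv s t.
Proof. by case: s t => [h|] [k|] //=; rewrite /ltv /addv /= oag_leD2lE. Qed.

Lemma ltv_fin s t : ltv s t -> exists g, s = Some g.
Proof. by case: s t => [g|] [h|] //= _; exists g. Qed.

Lemma ltv_addv s t u v : ltv s t -> lev u v -> u <> None ->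
  ltv (addv s u) (addv t v).
Proof.
case: s t u v => [g|] [h|] [k|] [l|] //=; rewrite /ltv /addv /= -?oag_ltNge // => *.
exact: oag_ltr_leD.
Qed.

Lemma lev_min s t u : lev s (minv t u) = lev s t && lev s u.
Proof.
rewrite /minv; case: ifP => tu; apply/idP/idP => [su|/andP[]//].
  by rewrite su (lev_trans su tu).
by rewrite su andbT (lev_trans su) // ltv_lev // /ltv tu.
Qed.

Lemma ltv_min s t u : ltv s (minv t u) = ltv s t && ltv s u.
Proof.
rewrite /minv; case: ifP => tu; apply/idP/idP => [su|/andP[]//].
  by rewrite su (ltv_lev_trans su tu).
by rewrite su andbT (ltv_lev_trans su) // ltv_lev // /ltv tu.
Qed.

Lemma lev_bigmin (I : Type) (r : seq I) (P : pred I) (F : I -> option G) s :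
  lev s (\big[@minv G/None]_(i <- r | P i) F i) = all (fun i => P i ==> lev s (F i)) r.
Proof.
elim: r => [|i r IHr] /=; first by rewrite big_nil levoo.
by rewrite big_cons; case: ifP => //=; rewrite lev_min IHr.
Qed.

Lemma lev_bigminP (n : nat) (F : 'I_n -> option G) s :
  reflect (forall i, lev s (F i)) (lev s (\big[@minv G/None]_(i < n) F i)).
Proof.
rewrite lev_bigmin; apply: (iffP allP) => [sF i|sF i _]; last by rewrite sF.
exact: (sF i (mem_index_enum _)).
Qed.

End ExtendedValueTheory.

(** * Elementary properties and constructions of valuations *)

Section ValuationTheory.
Variables (L : fieldType) (G : orderedZmodType) (v : valuation L G).
Implicit Types x y z : L.

Lemma vfun_neq0 x : x != 0 -> exists g, v x = Some g.
Proof.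
case E: (v x) => [g|] x0; first by exists g.
by move: x0; rewrite ((vfun_eqoo v x).1 E) eqxx.
Qed.

Lemma vfun_fin_neq0 x g : v x = Some g -> x != 0.
Proof. by move=> vx; apply/eqP => x0; rewrite x0 vfun0 in vx. Qed.

Lemma vfunV x g : v x = Some g -> v x^-1 = Some (- g).
Proof.
move=> vx; have := vfunM v x x^-1; rewrite mulfV ?(vfun_fin_neq0 vx) // vfun1 vx.
by case: (v x^-1) => //= h [gh]; congr Some; rewrite -[RHS]addr0 gh addKr.
Qed.

Lemma vfunX x g n : v x = Some g -> v (x ^+ n) = Some (g *+ n).
Proof.
move=> vx; elim: n => [|n IHn]; first by rewrite vfun1.
by rewrite exprS vfunM vx IHn mulrS.
Qed.

Lemma lev_vfunD s x y : lev s (v x) -> lev s (v y) -> lev s (v (x + y)).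
Proof.
by move=> sx sy; apply: lev_trans (vfunD v x y); rewrite lev_min sx.
Qed.

Lemma ltv_vfunD s x y : ltv s (v x) -> ltv s (v y) -> ltv s (v (x + y)).
Proof.
by move=> sx sy; apply: ltv_lev_trans (vfunD v x y); rewrite ltv_min sx.
Qed.

Lemma lev_vfunB s x y : lev s (v x) -> lev s (v y) -> lev s (v (x - y)).
Proof. by move=> sx sy; apply: lev_vfunD => //; rewrite vfunN. Qed.

Lemma vfunBC x y : v (x - y) = v (y - x). Proof. by rewrite -opprB vfunN. Qed.

Lemma lev_vsum (I : Type) (r : seq I) (P : pred I) (F : I -> L) s :
  (forall i, P i -> lev s (v (F i))) -> lev s (v (\sum_(i <- r | P i) F i)).
Proof.
move=> sF; elim/big_ind: _ => //; last by move=> ? ?; exact: lev_vfunD.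
by rewrite vfun0 levoo.
Qed.

Lemma ltv_vsum (I : Type) (r : seq I) (P : pred I) (F : I -> L) (g : G) :
  (forall i, P i -> ltv (Some g) (v (F i))) ->
  ltv (Some g) (v (\sum_(i <- r | P i) F i)).
Proof.
move=> sF; elim/big_ind: _ => //; last by move=> ? ?; exact: ltv_vfunD.
by rewrite vfun0.
Qed.

Lemma vfunD_dom x y : ltv (v x) (v y) -> v (x + y) = v x.
Proof.
move=> xy; apply: lev_anti; last by apply: lev_vfunD; [exact: levv | exact: ltv_lev].
rewrite -[lev _ _]negbK; apply/negP => xxy.
suff : ltv (v x) (v x) by rewrite /ltv levv.
by rewrite -{2}[x](addrK y) ltv_vfunD // vfunN.
Qed.

End ValuationTheory.

Section ValuationConstructions.
Variables (L M : fieldType) (G : orderedZmodType).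

Section Comp.
Variables (v : valuation M G) (f : {rmorphism L -> M}).

Let comp_eqoo z : (v \o f) z = None <-> z = 0.
Proof.
rewrite /= vfun_eqoo; split=> [/eqP|->]; last exact: rmorph0.
by rewrite fmorph_eq0 => /eqP.
Qed.

Let compM z w : (v \o f) (z * w) = addv ((v \o f) z) ((v \o f) w).
Proof. by rewrite /= rmorphM vfunM. Qed.

Let compD z w : lev (minv ((v \o f) z) ((v \o f) w)) ((v \o f) (z + w)).
Proof. by rewrite /= rmorphD vfunD. Qed.

Definition comp_valuation := Valuation comp_eqoo compM compD.

Lemma comp_valuationE z : comp_valuation z = v (f z). Proof. by []. Qed.

End Comp.

Definition trivial_vfun (z : L) : option G := if z == 0 then None else Some 0.

Let trivial_eqoo z : trivial_vfun z = None <-> z = 0.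
Proof. by rewrite /trivial_vfun; case: eqP. Qed.

Let trivialM z w : trivial_vfun (z * w) = addv (trivial_vfun z) (trivial_vfun w).
Proof.
by rewrite /trivial_vfun mulf_eq0; do 2!case: (_ == 0) => //=; rewrite /addv addr0.
Qed.

Let trivialD z w :
  lev (minv (trivial_vfun z) (trivial_vfun w)) (trivial_vfun (z + w)).
Proof.
rewrite /trivial_vfun /minv; have [->|z0] := eqVneq z 0.
  by rewrite add0r; case: (w == 0) => //=; rewrite lexx.
have [->|w0] := eqVneq w 0; first by rewrite addr0 (negPf z0) /= lexx.
by rewrite /= lexx; case: (z + w == 0); rewrite /= ?lexx.
Qed.

Definition trivial_valuation := Valuation trivial_eqoo trivialM trivialD.

Lemma trivial_valuationE z : trivial_valuation z = if z == 0 then None else Some 0.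
Proof. by []. Qed.

End ValuationConstructions.

(** * Partial field morphisms and subfields as abstract fields *)

Section PartialMorphisms.
Variable L : fieldType.

(* A partial field morphism from L to L, through its graph. *)
Definition is_morphism_graph (S : set (L * L)) : Prop :=
  [/\ S (1, 1), forall p q, S p -> S q -> S (p.1 - q.1, p.2 - q.2),
      forall p q, S p -> S q -> S (p.1 * q.1, p.2 * q.2),
      forall p, S p -> S (p.1^-1, p.2^-1)
    & forall p, S p -> (p.1 == 0) = (p.2 == 0)].

Record morphism_graph :=
  MorphismGraph { mg_set :> set (L * L); mg_P : is_morphism_graph mg_set }.

Variable S : morphism_graph.

Definition mg_pred : {pred L * L} := [pred p | `[< mg_set S p >]].

Lemma mg_predE p : (p \in mg_pred) = `[< mg_set S p >]. Proof. by []. Qed.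

Lemma mg_subring : subring_closed mg_pred.
Proof.
have [S1 SB SM _ _] := mg_P S.
split=> [|p q /asboolP Sp /asboolP Sq|p q /asboolP Sp /asboolP Sq].
- exact/asboolP.
- exact/asboolP/(SB _ _ Sp Sq).
- exact/asboolP/(SM _ _ Sp Sq).
Qed.

HB.instance Definition _ :=
  GRing.isSubringClosed.Build (L * L)%type mg_pred mg_subring.

Record mg_field := MgElt { mg_val :> L * L; _ : mg_val \in mg_pred }.
HB.instance Definition _ := [isSub for mg_val].
HB.instance Definition _ := [Choice of mg_field by <:].
HB.instance Definition _ := [SubChoice_isSubComNzRing of mg_field by <:].

Definition mg_inv (z : mg_field) : mg_field :=
  insubd 0 ((mg_val z).1^-1, (mg_val z).2^-1).

Lemma mg_field_setP (z : mg_field) : mg_set S (mg_val z).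
Proof. by case: z => z /= /asboolP. Qed.

Lemma mg_invE (z : mg_field) :
  mg_val (mg_inv z) = ((mg_val z).1^-1, (mg_val z).2^-1).
Proof.
rewrite [mg_val _]insubdK // mg_predE; apply/asboolP.
by have [_ _ _ SV _] := mg_P S; apply: SV; exact: mg_field_setP.
Qed.

Lemma mg_mulV (z : mg_field) : z != 0 -> mg_inv z * z = 1.
Proof.
move=> z0; apply: val_inj.
rewrite [LHS](_ : _ = mg_val (mg_inv z) * mg_val z) // mg_invE.
have [_ _ _ _ S0] := mg_P S; have := S0 _ (mg_field_setP z).
have : mg_val z != 0 by apply: contra z0 => /eqP z0; apply/eqP/val_inj.
case: (mg_val z) => x y /= xy0 x0y0.
have [y0|y0] := eqVneq y 0.
  by move: x0y0 xy0; rewrite y0 eqxx => /eqP ->; rewrite eqxx.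
by rewrite [LHS](_ : _ = (x^-1 * x, y^-1 * y)) // !mulVf // x0y0.
Qed.

Lemma mg_inv0 : mg_inv 0 = 0.
Proof. by apply: val_inj; rewrite [LHS]mg_invE /= invr0. Qed.

HB.instance Definition _ :=
  GRing.ComNzRing_isField.Build mg_field mg_mulV mg_inv0.

Definition mg_src (z : mg_field) : L := (mg_val z).1.
Definition mg_tgt (z : mg_field) : L := (mg_val z).2.

Lemma mg_src_zmod : zmod_morphism mg_src. Proof. by []. Qed.
Lemma mg_src_monoid : monoid_morphism mg_src. Proof. by []. Qed.
Lemma mg_tgt_zmod : zmod_morphism mg_tgt. Proof. by []. Qed.
Lemma mg_tgt_monoid : monoid_morphism mg_tgt. Proof. by []. Qed.

HB.instance Definition _ := GRing.isZmodMorphism.Build mg_field L mg_src mg_src_zmod.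
HB.instance Definition _ := GRing.isMonoidMorphism.Build mg_field L mg_src mg_src_monoid.
HB.instance Definition _ := GRing.isZmodMorphism.Build mg_field L mg_tgt mg_tgt_zmod.
HB.instance Definition _ := GRing.isMonoidMorphism.Build mg_field L mg_tgt mg_tgt_monoid.

Lemma mg_setP x y : mg_set S (x, y) -> exists z : mg_field, mg_src z = x /\ mg_tgt z = y.
Proof. by move=> /asboolP Sxy; exists (MgElt Sxy). Qed.

Lemma mg_srctgtP (z : mg_field) : mg_set S (mg_src z, mg_tgt z).
Proof. by have := mg_field_setP z; rewrite /mg_src /mg_tgt; case: (mg_val z). Qed.

End PartialMorphisms.

(** The graph is a subring of the square of [L], and the condition on zeros lets inverses be taken
    componentwise; it is therefore a field whose two projections are embeddings. A partial map
    becomes a pair of embeddings of one abstract field, over which minimal polynomials make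
    sense. *)
Lemma morphism_graph_field (L : fieldType) (S : set (L * L)) :
  is_morphism_graph S -> exists (F : fieldType) (i i' : {rmorphism F -> L}),
    forall x y, S (x, y) <-> exists z, i z = x /\ i' z = y.
Proof.
move=> SP; pose T := MorphismGraph SP.
exists (mg_field T), (@mg_src L T : {rmorphism _ -> _}), (@mg_tgt L T : {rmorphism _ -> _}).
move=> x y; split; first exact: (@mg_setP _ T).
by case=> z [<- <-]; exact: (@mg_srctgtP _ T).
Qed.

Section SubfieldTheory.
Variable L : fieldType.
Implicit Types F E : set L.

Lemma subfield0 F : is_subfield F -> F 0.
Proof. by case=> F1 FB _; rewrite -(subrr 1); exact: FB. Qed.

Lemma subfieldN F x : is_subfield F -> F x -> F (- x).
Proof. by move=> sF Fx; have [_ FB _] := sF; rewrite -sub0r; apply: FB => //; exact: subfield0. Qed.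

Lemma subfieldD F x y : is_subfield F -> F x -> F y -> F (x + y).
Proof.
move=> sF Fx Fy; have [_ FB _] := sF.
by rewrite -[y]opprK; apply: FB => //; exact: subfieldN.
Qed.

Lemma subfieldV F x : is_subfield F -> F x -> F x^-1.
Proof. by case=> F1 _ FV Fx; rewrite -div1r; exact: FV. Qed.

Lemma subfieldM F x y : is_subfield F -> F x -> F y -> F (x * y).
Proof.
move=> sF Fx Fy; have [_ _ FV] := sF.
by rewrite -[y]invrK; apply: FV => //; exact: subfieldV.
Qed.

Lemma subfieldX F x n : is_subfield F -> F x -> F (x ^+ n).
Proof.
move=> sF Fx; elim: n => [|n IHn]; first by case: sF.
by rewrite exprS; exact: subfieldM.
Qed.

Lemma subfield_sum F (I : Type) (r : seq I) (P : pred I) (f : I -> L) :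
  is_subfield F -> (forall i, P i -> F (f i)) -> F (\sum_(i <- r | P i) f i).
Proof.
move=> sF Ff; elim/big_ind: _ => //; first exact: subfield0.
by move=> x y; exact: subfieldD.
Qed.

Lemma subfield_graph F : is_subfield F ->
  is_morphism_graph [set p | F p.1 /\ p.2 = p.1].
Proof.
move=> sF; split=> [|[x _] [y _]/= [Fx ->] [Fy ->]|[x _] [y _]/= [Fx ->] [Fy ->]
  |[x _]/= [Fx ->]|[x _]/= [Fx ->]] //.
- by case: sF.
- by case: sF => _ FB _; split=> //; exact: FB.
- by split=> //; exact: subfieldM.
- by split=> //; exact: subfieldV.
Qed.

(** The diagonal over [F] is a morphism graph, so the same construction turns a subfield given as a
    set into a field type with an embedding. *)
Lemma subfield_field F : is_subfield F ->
  exists (F' : fieldType) (i : {rmorphism F' -> L}), range i = F.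
Proof.
move=> /subfield_graph /morphism_graph_field[F' [i [i' SP]]].
exists F', i; apply/seteqP; split=> [_ [z _ <-]|x Fx].
  by have [] := (SP (i z) (i' z)).2 (ex_intro _ z (conj erefl erefl)).
by have [z [<- _]] := (SP x x).1 (conj Fx erefl); exists z.
Qed.

Lemma subfield_range (F : fieldType) (i : {rmorphism F -> L}) :
  is_subfield (range i).
Proof.
split=> [|_ _ [y _ <-] [z _ <-]|_ _ [y _ <-] [z _ <-]].
- by exists 1; rewrite ?rmorph1.
- by exists (y - z); rewrite ?rmorphB.
- by exists (y / z); rewrite ?fmorph_div.
Qed.

Lemma subfield_bigcap (D : set (set L)) :
  (forall F, D F -> is_subfield F) -> is_subfield (\bigcap_(F in D) F).
Proof.
move=> DF; split=> [F FD|x y Fx Fy F FD|x y Fx Fy F FD]; have [F1 FB FV] := DF F FD.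
- exact: F1.
- by apply: FB; [exact: Fx | exact: Fy].
- by apply: FV; [exact: Fx | exact: Fy].
Qed.

Lemma subfield_adjoin F x : is_subfield (adjoin F x).
Proof. by apply: subfield_bigcap => E []. Qed.

Lemma sub_adjoin F x : F `<=` adjoin F x.
Proof. by move=> y Fy E [_ FE _]; exact: FE. Qed.

Lemma mem_adjoin F x : adjoin F x x.
Proof. by move=> E []. Qed.

Lemma adjoin_min F E x : is_subfield E -> F `<=` E -> E x -> adjoin F x `<=` E.
Proof. by move=> sE FE Ex y; apply. Qed.

End SubfieldTheory.

Arguments sub_adjoin {L} F x [t] _.
Arguments mem_adjoin {L} F x.

(** * Characteristic polynomials of multiplication maps *)

Lemma closed_poly_ext (L : closedFieldType) (p q : {poly L}) :
  (forall x, p.[x] = q.[x]) -> p = q.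
Proof.
move=> pq; apply/eqP; rewrite -subr_eq0; apply/negPn/negP => /closed_nonrootP[x].
by rewrite rootE !hornerE pq subrr eqxx.
Qed.

Lemma closed_monic_split (L : closedFieldType) (p : {poly L}) :
  p \is monic -> exists rs, p = \prod_(r <- rs) ('X - r%:P).
Proof.
move=> /monicP pM; have [rs ->] := closed_field_poly_normal p.
by exists rs; rewrite pM scale1r.
Qed.

Section NormPolynomials.

Lemma char_poly_ex (F : fieldType) (p : {poly F}) : p \is monic ->
  (1 < size p)%N -> exists n' (A : 'M[F]_n'.+1), char_poly A = p.
Proof.
move=> /companionmxK; move: (companionmx p).
case: (size p) => [|[|n]]//= A AE _; by exists n, A.
Qed.

Variable L : closedFieldType.
Implicit Types (h : {poly L}) (rs : seq L).

(** Splitting [h] instead of triangularising [A]: each factor [A - z] has a determinant given by the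
    characteristic polynomial at [z], and the double product over the roots of [h] and the
    eigenvalues is then exchanged. *)
Lemma det_horner_mx n (A : 'M[L]_n.+1) rs h :
  char_poly A = \prod_(r <- rs) ('X - r%:P) ->
  \det (horner_mx A h) = \prod_(r <- rs) h.[r].
Proof.
move=> AE; have srs : size rs = n.+1.
  by have := size_char_poly A; rewrite AE size_prod_XsubC => -[].
have detA z : \det (A - z%:M) = \prod_(r <- rs) (r - z).
  have /(congr1 (horner_eval z)) := AE.
  rewrite /char_poly -det_map_mx rmorph_prod /=.
  set B := map_mx _ _; have -> : B = (-1) *: (A - z%:M).
    apply/matrixP => k l; rewrite !mxE /horner_eval !hornerE hornerMn hornerX.
    by rewrite mulN1r opprB.
  rewrite detZ => BE; have := congr1 (fun y => (-1) ^+ n.+1 * y) BE.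
  rewrite mulrA -expr2 sqrr_sign mul1r => ->; rewrite -srs.
  elim: (rs) => [|r s IHs]; first by rewrite !big_nil mulr1.
  rewrite !big_cons -IHs exprS mulrACA /horner_eval !hornerE.
  by rewrite mulN1r opprB.
have [s hE] := closed_field_poly_normal h.
have -> : horner_mx A h = lead_coef h *: \prod_(z <- s) (A - z%:M).
  rewrite {1}hE linearZ /= rmorph_prod; congr (_ *: _); apply: eq_bigr => z _.
  by rewrite rmorphB /= horner_mx_X horner_mx_C.
have -> : \det (lead_coef h *: \prod_(z <- s) (A - z%:M)) =
    lead_coef h ^+ n.+1 * \prod_(z <- s) \prod_(r <- rs) (r - z).
  rewrite detZ (big_morph _ (@det_mulmx _ _) (det1 _ _)); congr (_ * _).
  by apply: eq_bigr => z _.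
rewrite exchange_big -srs; elim: (rs) => [|r t IHt]; first by rewrite !big_nil mulr1.
rewrite !big_cons exprS mulrACA IHt; congr (_ * _).
rewrite [in RHS]hE hornerZ horner_prod; congr (_ * _).
by apply: eq_bigr => z _; rewrite !hornerE.
Qed.

Lemma char_poly_horner_mx n (A : 'M[L]_n.+1) rs h :
  char_poly A = \prod_(r <- rs) ('X - r%:P) ->
  char_poly (horner_mx A h) = \prod_(r <- rs) ('X - (h.[r])%:P).
Proof.
move=> AE; apply: closed_poly_ext => x; rewrite horner_prod.
transitivity (\det (horner_mx A (x%:P - h))).
  rewrite -[LHS]/(horner_eval x _) /char_poly -det_map_mx; congr (\det _).
  have -> : horner_mx A (x%:P - h) = x%:M - horner_mx A h.
    by rewrite rmorphB /= horner_mx_C.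
  apply/matrixP => k l; rewrite !mxE /= /horner_eval.
  by rewrite hornerD hornerN hornerMn hornerX hornerC.
rewrite (det_horner_mx _ AE); apply: eq_bigr => r _.
by rewrite !hornerE.
Qed.

End NormPolynomials.

(* The characteristic polynomial over F[t] of multiplication by
   \sum_k P_k t^k on F[t][X]/(p). *)
Lemma norm_poly_ex (F : fieldType) (p : {poly F}) m (P : 'I_m -> {poly F}) :
  p \is monic -> (1 < size p)%N ->
  exists C : {poly {poly F}},
    forall (L : closedFieldType) (i : {rmorphism F -> L}) (rs : seq L),
      map_poly i p = \prod_(r <- rs) ('X - r%:P) ->
      map_poly (map_poly i) C =
        \prod_(r <- rs) ('X - (\sum_(k < m) (map_poly i (P k)).[r] *: 'X^k)%:P).
Proof.
move=> pM p1; have [n [A AE]] := char_poly_ex pM p1.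
exists (char_poly (\sum_(k < m) 'X^k *: map_mx polyC (horner_mx A (P k)))).
move=> L i rs iE; rewrite map_char_poly.
set B := map_mx _ _; set Cl := char_poly _; set Cr := \prod_(r <- rs) _.
have iAE : char_poly (map_mx i A) = \prod_(r <- rs) ('X - r%:P).
  by rewrite -map_char_poly AE.
(* The coefficients lie in L[t] with [L] infinite, so it is enough to specialise t to every element
   of [L]; the matrix then becomes a polynomial in [A] over [L]. *)
suff CE t : map_poly (horner_eval t) Cl = map_poly (horner_eval t) Cr.
  apply/polyP => k; apply: closed_poly_ext => t.
  by have := congr1 (fun q : {poly L} => q`_k) (CE t); rewrite /= !coef_map.
rewrite map_char_poly.
have -> : map_mx (horner_eval t) B =
    horner_mx (map_mx i A) (\sum_(k < m) t ^+ k *: map_poly i (P k)).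
  rewrite /B raddf_sum /= raddf_sum /= raddf_sum /=; apply: eq_bigr => k _.
  rewrite linearZ /= -map_horner_mx; apply/matrixP => u v.
  by rewrite !mxE /= rmorphM /= map_polyXn map_polyC /= /horner_eval !hornerE.
rewrite (char_poly_horner_mx _ iAE) rmorph_prod; apply: eq_bigr => r _.
rewrite rmorphB /= map_polyX map_polyC /=; congr (_ - _%:P).
rewrite /horner_eval !horner_sum; apply: eq_bigr => k _.
by rewrite !hornerE mulrC.
Qed.

Lemma norm_poly1_ex (F : fieldType) (p P : {poly F}) :
  p \is monic -> (1 < size p)%N ->
  exists C : {poly F},
    forall (L : closedFieldType) (i : {rmorphism F -> L}) (rs : seq L),
      map_poly i p = \prod_(r <- rs) ('X - r%:P) ->
      map_poly i C = \prod_(r <- rs) ('X - ((map_poly i P).[r])%:P).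
Proof.
move=> pM p1; have [C CE] := norm_poly_ex (fun _ : 'I_1 => P) pM p1.
exists (map_poly (horner_eval 0) C) => L i rs /CE /(congr1 (map_poly (horner_eval 0))).
have -> : map_poly (horner_eval 0) (map_poly (map_poly i) C) =
    map_poly i (map_poly (horner_eval 0) C).
  apply/polyP => k; rewrite !coef_map /= /horner_eval.
  by rewrite -{1}(rmorph0 i) horner_map.
move=> ->; rewrite rmorph_prod; apply: eq_bigr => r _.
rewrite rmorphB /= map_polyX map_polyC /=; congr (_ - _%:P).
by rewrite /horner_eval big_ord1 expr0 !hornerE.
Qed.

(** * Minimal polynomials *)

Section MinimalPolynomials.
Variables (F : fieldType) (L : closedFieldType) (i : {rmorphism F -> L}).
Implicit Types (u : L) (p q : {poly F}).

Lemma minpoly_ex u : algebraicOver i u -> exists p, is_minpoly i u p.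
Proof.
case=> p0 p0N rp0.
pose Q n := `[< exists q, [/\ q != 0, root (map_poly i q) u & size q = n] >].
have exQ : exists n, Q n by exists (size p0); apply/asboolP; exists p0.
case: (ex_minnP exQ) => n /asboolP[q [qN rq <-]] qmin.
have {}qmin r : r != 0 -> root (map_poly i r) u -> (size q <= size r)%N.
  by move=> rN rr; apply: qmin; apply/asboolP; exists r.
have lN : (lead_coef q)^-1 != 0 by rewrite invr_eq0 lead_coef_eq0.
exists ((lead_coef q)^-1 *: q); split.
- by rewrite monicE lead_coefZ mulVf // lead_coef_eq0.
- split=> [|r rs1]; rewrite ?size_scale //.
    rewrite ltnNge; apply/negP => /size1_polyC qC; move: qN rq; rewrite qC.
    by rewrite polyC_eq0 map_polyC rootC fmorph_eq0 => /negPf ->.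
  rewrite dvdpZr // => /dvdpP[s qE].
  have sN : s != 0 by apply: contraNneq qN => s0; rewrite qE s0 mul0r.
  have rN : r != 0 by apply: contraNneq qN => r0; rewrite qE r0 mulr0.
  rewrite eqp_sym (eqp_trans (eqp_scale _ lN)) // eqp_sym.
  have rq' : r %| q by rewrite qE dvdp_mull.
  rewrite -dvdp_size_eqp // eqn_leq dvdp_leq //.
  have /orP[rs|rr] : root (map_poly i s) u || root (map_poly i r) u.
      by rewrite -rootM -rmorphM -qE.
    have := qmin _ sN rs; rewrite {1}qE size_mul //.
    have : (size r != 0)%N by rewrite size_poly_eq0.
    by move: rs1; case: (size r) => [|[|k]]//= _ _; rewrite addnS /= -[X in (_ <= X)%N]addn0 leq_add2l.
  exact: qmin.
- by rewrite linearZ /= rootZ // fmorph_eq0.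
Qed.

Lemma minpoly_rootE u p q : is_minpoly i u p -> root (map_poly i q) u = (p %| q).
Proof.
case=> pM pI rp; apply/idP/idP => [rq|pq]; last first.
  by have /dvdpP[s ->] := pq; rewrite rmorphM rootM rp orbT.
apply/negPn/negP => pq.
have [pI1 pI2] := pI.
have cpq : coprimep p q.
  rewrite coprimep_def; apply/negPn/negP => g1.
  have := pI2 _ g1 (dvdp_gcdl _ _); rewrite /eqp => /andP[_ pg].
  by move: pq; rewrite (dvdp_trans pg) // dvdp_gcdr.
have : coprimep (map_poly i p) (map_poly i q) by rewrite coprimep_map.
by move=> /coprimep_root /(_ rp); rewrite -rootE rq.
Qed.

Lemma minpoly_inv u p q : is_minpoly i u p -> (map_poly i q).[u] != 0 ->
  exists q', p %| q * q' - 1.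
Proof.
move=> pu; rewrite -rootE (minpoly_rootE q pu) => pq; have [pM pI rp] := pu.
have cpq : coprimep p q.
  rewrite coprimep_def; apply/negPn/negP => g1.
  have := pI.2 _ g1 (dvdp_gcdl _ _); rewrite /eqp => /andP[_ pg].
  by move: pq; rewrite (dvdp_trans pg) // dvdp_gcdr.
have [[s t] /= stE] := Bezout_eq1_coprimepP _ _ cpq; exists t.
have -> : q * t - 1 = - s * p.
  by rewrite -stE mulNr [q * t]mulrC opprD addrCA subrr addr0.
exact: dvdp_mull.
Qed.

End MinimalPolynomials.

(** * The Gauss valuation on polynomials *)

Section GaussValuation.
Variables (L : fieldType) (G : orderedZmodType) (v : valuation L G).
Implicit Types p q : {poly L}.

Definition gauss p : option G := \big[@minv G/None]_(i < size p) v p`_i.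

Lemma lev_gaussP s p : lev s (gauss p) <-> forall i, lev s (v p`_i).
Proof.
split=> [/lev_bigminP sp i|sp]; last exact/lev_bigminP.
have [ip|pi] := ltnP i (size p); first exact: (sp (Ordinal ip)).
by rewrite nth_default // vfun0 levoo.
Qed.

Lemma gauss_le p i : lev (gauss p) (v p`_i).
Proof. exact: ((lev_gaussP _ _).1 (levv _)). Qed.

(** The least index is required so that, in a product, the coefficient at the sum of the two least
    indices has a single term of least value; this is Gauss's lemma. *)
Lemma gauss_attained p : p != 0 -> exists2 i, gauss p = v p`_i &
  forall k, (k < i)%N -> ltv (gauss p) (v p`_k).
Proof.
move=> p0; have exi : exists i, v p`_i == gauss p.
  suff [gN|[i ->]] : gauss p = None \/ exists i, gauss p = v p`_i.
  - exists (size p).-1; have := gauss_le p (size p).-1; rewrite gN.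
    by case: (v _).
  - by exists i.
  rewrite /gauss; elim/big_ind: _ => [|s t [->|[i ->]] [->|[k ->]]|i _].
  - by left.
  - by left.
  - by right; exists k; rewrite /minv; case: (v _).
  - by right; exists i; rewrite /minv levoo.
  - by right; rewrite /minv; case: ifP => _; [exists i | exists k].
  - by right; exists i.
case: (ex_minnP exi) => i /eqP vi imin; exists i => // k ki.
apply/negP => kg; suff : (i <= k)%N by rewrite leqNgt ki.
by apply: imin; apply/eqP; apply: lev_anti kg (gauss_le _ _).
Qed.

Lemma gauss0 : gauss 0 = None.
Proof. by rewrite /gauss size_poly0 big_ord0. Qed.

Lemma gauss_fin p : p != 0 -> exists g, gauss p = Some g.
Proof.
move=> p0; case E: (gauss p) => [g|]; first by exists g.
have := gauss_le p (size p).-1; rewrite E.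
have /(vfun_neq0 v)[g ->//] : p`_(size p).-1 != 0.
by rewrite -lead_coefE lead_coef_eq0.
Qed.

Lemma gaussN p : gauss (- p) = gauss p.
Proof.
by apply: lev_anti; apply/lev_gaussP => i; have := gauss_le p i;
  have := gauss_le (- p) i; rewrite coefN vfunN.
Qed.

Lemma ltv_gauss (g : G) p : (forall i, ltv (Some g) (v p`_i)) -> ltv (Some g) (gauss p).
Proof.
have [->|p0] := eqVneq p 0; first by rewrite gauss0.
by have [i -> _] := gauss_attained p0.
Qed.

Lemma ltv_gaussD s p q : ltv s (gauss p) -> ltv s (gauss q) -> ltv s (gauss (p + q)).
Proof.
case: s => [g|]; last by rewrite /ltv levoo.
move=> sp sq; apply: ltv_gauss => i; rewrite coefD.
by apply: ltv_vfunD; [apply: ltv_lev_trans sp _|apply: ltv_lev_trans sq _]; exact: gauss_le.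
Qed.

Lemma gaussM p q : gauss (p * q) = addv (gauss p) (gauss q).
Proof.
have [->|p0] := eqVneq p 0; first by rewrite mul0r gauss0.
have [->|q0] := eqVneq q 0; first by rewrite mulr0 gauss0 addvoo.
apply: lev_anti; last first.
  apply/lev_gaussP => k; rewrite coefM; apply: lev_vsum => i _.
  by rewrite vfunM lev_addv // gauss_le.
have [i vi imin] := gauss_attained p0; have [k vk kmin] := gauss_attained q0.
have [g pg] := gauss_fin p0; have [h qh] := gauss_fin q0.
have ik : (i < (i + k).+1)%N by rewrite ltnS leq_addr.
suff <- : v (p * q)`_(i + k) = addv (gauss p) (gauss q) by exact: gauss_le.
rewrite coefM (bigD1 (Ordinal ik)) //= addKn vfunD_dom vfunM -vi -vk //.
rewrite pg qh /= /addv; apply: ltv_vsum => l li.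
have -> : Some (g + h) = addv (Some g) (Some h) by [].
rewrite vfunM; have [lti|gti|lEi] := ltngtP l i.
- by apply: ltv_addv; rewrite -?pg -?qh ?gauss_le ?imin // qh.
- rewrite addvC [X in ltv _ X]addvC; apply: ltv_addv; rewrite -?pg -?qh ?gauss_le ?pg //.
  apply: kmin; have := ltn_ord l; rewrite ltnS => lik.
  by rewrite ltn_subLR // ltn_add2r.
- by move: li; rewrite -val_eqE /= lEi eqxx.
Qed.

Lemma gauss1 : gauss 1 = Some 0.
Proof. by rewrite /gauss size_poly1 big_ord_recl big_ord0 coef1 /= vfun1. Qed.

Lemma gaussX_ge0 p n : lev (Some 0) (gauss p) -> lev (Some 0) (gauss (p ^+ n)).
Proof.
move=> p0; elim: n => [|n IHn]; first by rewrite gauss1 levv.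
by rewrite exprS gaussM -[Some 0]add0v lev_addv.
Qed.

Lemma gauss_map_eq (F : fieldType) (i : {rmorphism F -> L}) (M : fieldType)
    (w : valuation M G) (i' : {rmorphism F -> M}) (p : {poly F}) :
  (forall c, v (i c) = w (i' c)) ->
  gauss (map_poly i p) = \big[@minv G/None]_(k < size p) w (i' p`_k).
Proof.
by move=> vw; rewrite /gauss size_map_poly; apply: eq_bigr => k _; rewrite coef_map vw.
Qed.

(* All the roots are outside the valuation ring, so the constant coefficient
   dominates strictly. *)
Lemma gauss_prod_XsubC (ys : seq {poly L}) (f := \prod_(y <- ys) ('X - y%:P)) :
  (forall y, y \in ys -> ltv (gauss y) (Some 0)) ->
  f`_0 != 0 /\ forall k, ltv (gauss f`_0) (gauss f`_k.+1).
Proof.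
rewrite /f {f}; elim: ys => [|y ys IHys] ysN.
  by rewrite big_nil coef1 oner_neq0; split=> // k; rewrite coef1 gauss1 gauss0.
have [z|] := IHys; first by move=> zs; apply: ysN; rewrite inE zs orbT.
move=> f0 fk.
have yN : ltv (gauss y) (Some 0) by apply: ysN; rewrite inE eqxx.
rewrite big_cons; set f := \prod_(z <- ys) _ in f0 fk *.
have [h yh] := ltv_fin yN; have [g fg] := gauss_fin f0.
have y0 : y != 0 by apply: contraPneq yh => ->; rewrite gauss0.
have fE k : (('X - y%:P) * f)`_k = (if k is k'.+1 then f`_k' else 0) - y * f`_k.
  by rewrite mulrBl coefB coefXM coefCM; case: k.
have f0E : (('X - y%:P) * f)`_0 = - (y * f`_0) by rewrite fE sub0r.
have f0lt : ltv (gauss (- (y * f`_0))) (gauss f`_0).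
  rewrite gaussN gaussM -[X in ltv _ X]add0v fg yh.
  by rewrite ltv_addv ?levv // -yh.
rewrite f0E; split=> [|k]; first by rewrite oppr_eq0 mulf_neq0.
rewrite fE; apply: ltv_gaussD.
  case: k => [|k]; first exact: f0lt.
  exact: ltv_lev_trans f0lt (ltv_lev (fk _)).
by rewrite !gaussN !gaussM yh ltv_addl fk.
Qed.

End GaussValuation.

(** * Values of algebraic elements *)

Section AlgebraicValues.
Variables (F : fieldType) (L : closedFieldType) (G : orderedZmodType).
Variable i : {rmorphism F -> L}.

(** In an algebraic relation for [z] the least value of a term must occur at two different indices,
    since otherwise the sum would have that finite value. Comparing these two terms gives the power
    of [z] and the constant. *)
Lemma algebraic_value_torsion (v : valuation L G) z : z != 0 -> algebraicOver i z ->
  exists m c, [/\ (0 < m)%N, c != 0 & v (z ^+ m) = v (i c)].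
Proof.
move=> z0 [p p0 rp].
pose q := \poly_(k < size p) (i p`_k * z ^+ k).
have qE k : q`_k = i p`_k * z ^+ k.
  rewrite coef_poly; case: ltnP => // pk.
  by rewrite nth_default // rmorph0 mul0r.
have qN : q != 0.
  apply: contraNneq p0 => q0; rewrite -lead_coef_eq0 lead_coefE.
  have := qE (size p).-1; rewrite q0 coef0 => /esym/eqP.
  by rewrite mulf_eq0 expf_eq0 (negPf z0) andbF orbF fmorph_eq0.
have q1 : \sum_(k < size q) q`_k = 0.
  transitivity (map_poly i p).[z]; last exact/eqP.
  rewrite horner_coef size_map_poly.
  transitivity (\sum_(k < size p) q`_k); last first.
    by apply: eq_bigr => k _; rewrite qE coef_map.
  rewrite (big_ord_widen _ (fun k => q`_k) (size_poly _ _)) big_mkcond /=.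
  by apply: eq_bigr => k _; case: ltnP => // qk; rewrite nth_default.
have [k vk _] := gauss_attained v qN; have [g qg] := gauss_fin v qN.
have [l lk vl] : exists2 l, l != k & v q`_l = v q`_k.
  apply/not_exists2P => vN.
  have kq : (k < size q)%N.
    rewrite ltnNge; apply/negP => kq.
    by move: vk; rewrite (nth_default _ kq) vfun0 qg.
  have := congr1 v q1; rewrite vfun0 (bigD1 (Ordinal kq)) //= vfunD_dom.
    by rewrite -vk qg.
  rewrite -vk qg; apply: ltv_vsum => l lk.
  rewrite -qg; apply/negP => lg.
  case: (vN l) => //; apply; rewrite -vk.
  by apply: lev_anti lg (gauss_le _ _ _).
have fin m : v q`_m = v q`_k -> p`_m != 0.
  rewrite -vk qg qE => vm; apply/eqP => pm.
  by move: vm; rewrite pm rmorph0 mul0r vfun0.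
have pk := fin k erefl; have pl := fin l vl.
have [h zh] := vfun_neq0 v z0.
wlog lk' : l k lk vl pk pl {vk fin} / (l < k)%N.
  move=> wl; have [/wl|/wl|lEk] := ltngtP l k; last by rewrite lEk eqxx in lk.
  - exact.
  - by apply => //; rewrite eq_sym.
exists (k - l)%N, (p`_l / p`_k); split.
- by rewrite subn_gt0.
- by rewrite mulf_neq0 ?invr_neq0.
have ipk : i p`_k != 0 by rewrite fmorph_eq0.
have ipl : i p`_l != 0 by rewrite fmorph_eq0.
have [s vs] := vfun_neq0 v ipk; have [t vt] := vfun_neq0 v ipl.
rewrite fmorph_div vfunM vt (vfunV vs) (vfunX _ zh) /addv.
move: vl; rewrite !qE !vfunM vs vt !(vfunX _ zh) /addv => -[ts].
rewrite mulrnBr ?(ltnW lk') //; congr Some; apply/eqP.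
by rewrite subr_eq addrAC ts [s + _]addrC addrK.
Qed.

Lemma algebraic_horner u (q : {poly F}) :
  algebraicOver i u -> algebraicOver i (map_poly i q).[u].
Proof.
move=> /integral_algebraic uI; apply/integral_algebraic/integral_horner => //.
by apply/integral_poly => k; rewrite coef_map; exact: integral_id.
Qed.

End AlgebraicValues.

(** * Extension of isometric embeddings *)

Section IsometricExtension.
Variables (F : fieldType) (L : closedFieldType) (G : orderedZmodType).
Variables (i i' : {rmorphism F -> L}) (w w' : valuation L G).
Hypothesis ww' : forall c, w (i c) = w' (i' c).

(** Inclusion of valuation rings suffices because values are torsion over [F]: some [q(u)^m / c] is
    a unit, it and its inverse are integral at [u], hence also at [u'], so it is a unit there too.
    Division by [m] is legitimate in the torsion-free group [G]. *)
Lemma isometric_of_integral (u u' : L) (p : {poly F}) :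
  is_minpoly i u p -> root (map_poly i' p) u' ->
  (forall q, lev (Some 0) (w (map_poly i q).[u]) ->
     lev (Some 0) (w' (map_poly i' q).[u'])) ->
  forall q, w (map_poly i q).[u] = w' (map_poly i' q).[u'].
Proof.
move=> pu rp' int q; have [pM pI rp] := pu.
have eval0 s : p %| s -> (map_poly i s).[u] = 0 /\ (map_poly i' s).[u'] = 0.
  by case/dvdpP => t ->; split; rewrite rmorphM hornerM ((rootP rp), (rootP rp')) mulr0.
have [q0|q0] := eqVneq (map_poly i q).[u] 0.
  have pq : p %| q by rewrite -(minpoly_rootE _ pu); apply/eqP.
  by have [_ ->] := eval0 q pq; rewrite q0 !vfun0.
have algu : algebraicOver i u by exists p => //; exact: monic_neq0.
have [m [c [m0 c0 qm]]] :=
  algebraic_value_torsion w q0 (algebraic_horner q algu).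
pose Q := c^-1 *: q ^+ m.
have [g qg] := vfun_neq0 w q0.
have ic0 : i c != 0 by rewrite fmorph_eq0.
have [h ch] := vfun_neq0 w ic0.
have QE (k : {rmorphism F -> L}) x :
    (map_poly k Q).[x] = (k c)^-1 * (map_poly k q).[x] ^+ m.
  by rewrite linearZ /= hornerZ fmorphV rmorphXn horner_exp.
have Qu : w (map_poly i Q).[u] = Some 0.
  by rewrite QE vfunM qm (vfunV ch) ch /addv addNr.
have [Q' /eval0[]] : exists Q', p %| Q * Q' - 1.
  apply: (minpoly_inv pu); apply/eqP => Q0; by rewrite Q0 vfun0 in Qu.
rewrite !rmorphB !rmorphM !rmorph1 !hornerE => /eqP Q'u /eqP Q'u'.
rewrite !subr_eq0 in Q'u Q'u'.
have Q'0 : w (map_poly i Q').[u] = Some 0.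
  by have /eqP/(congr1 w) := Q'u; rewrite vfunM Qu vfun1 add0v.
have Qu' : w' (map_poly i' Q).[u'] = Some 0.
  have := int Q; have := int Q'; rewrite Qu Q'0 levv => /(_ isT) s0 /(_ isT) t0.
  apply: lev_anti => //; have /eqP/(congr1 w') := Q'u'; rewrite vfunM vfun1.
  case: (w' _) t0 s0 => [s|] //=; case: (w' _) => [t|] //= s0 t0 [<-].
  exact: oag_ler_addr.
have q0' : (map_poly i' q).[u'] != 0.
  apply/eqP => q0'; move: Qu'; rewrite QE q0' expr0n.
  by case: (m) m0 => // ? _; rewrite mulr0 vfun0.
have [g' qg'] := vfun_neq0 w' q0'.
rewrite qg qg'; congr Some; apply: (oag_mulrIn m0) => /=; apply: Some_inj.
rewrite -(vfunX m qg) -(vfunX m qg') qm.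
move: Qu'; rewrite QE vfunM (vfunX m qg').
rewrite (vfunV (_ : _ = Some h)) -?ww' // ch /addv => -[/eqP].
by rewrite addrC subr_eq0 => /eqP ->.
Qed.

(* If every root r of i'(p) had some P_r with P_r(u) integral but P_r(r) not,
   then Y = \sum_r P_r t^r would be Gauss-integral at u and non-integral at all
   roots, while its characteristic polynomial is the same on both sides. *)
Lemma isometric_root (u : L) (p : {poly F}) : is_minpoly i u p ->
  exists2 u', root (map_poly i' p) u' &
    forall q, w (map_poly i q).[u] = w' (map_poly i' q).[u'].
Proof.
move=> pu; have [pM pI rp] := pu.
have [rs' rsE'] : exists rs, map_poly i' p = \prod_(r <- rs) ('X - r%:P).
  by apply: closed_monic_split; rewrite map_monic.
have [rs rsE] : exists rs, map_poly i p = \prod_(r <- rs) ('X - r%:P).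
  by apply: closed_monic_split; rewrite map_monic.
apply: contrapT => /forall2NP noroot.
have [P PP] : exists P : L -> {poly F}, forall r, r \in rs' ->
    lev (Some 0) (w (map_poly i (P r)).[u]) /\
    ltv (w' (map_poly i' (P r)).[r]) (Some 0).
  suff /choice[P PP] : forall r, exists q : {poly F}, r \in rs' ->
      lev (Some 0) (w (map_poly i q).[u]) /\
      ltv (w' (map_poly i' q).[r]) (Some 0) by exists P.
  move=> r; have [rrs|] := boolP (r \in rs'); last by exists 0.
  have rpr : root (map_poly i' p) r by rewrite rsE' root_prod_XsubC.
  apply: contrapT => /forallNP noq; have [//|] := noroot r; apply.
  apply: isometric_of_integral pu rpr _ => q q0.
  by apply/negPn/negP => qr; apply: (noq q).
have [C CE] := norm_poly_ex (fun k : 'I_(size rs') => P rs'`_k) pM pI.1.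
pose Y (k : {rmorphism F -> L}) (r : L) :=
  \sum_(l < size rs') (map_poly k (P rs'`_l)).[r] *: 'X^l.
have YE k r l : (Y k r)`_l = if (l < size rs')%N then (map_poly k (P rs'`_l)).[r] else 0.
  rewrite coef_sum; case: ltnP => ls.
    rewrite (bigD1 (Ordinal ls)) //= coefZ coefXn eqxx mulr1 big1 ?addr0 // => j.
    by rewrite -val_eqE /= coefZ coefXn eq_sym => /negPf ->; rewrite mulr0.
  rewrite big1 // => j _; rewrite coefZ coefXn gtn_eqF ?mulr0 //.
  exact: leq_trans (ltn_ord j) ls.
have Yu : lev (Some 0) (gauss w (Y i u)).
  apply/lev_gaussP => l; rewrite YE; case: ifP => [ls|_]; last by rewrite vfun0 levoo.
  by have [] := PP _ (mem_nth 0 ls).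
pose f := map_poly (map_poly i) C; pose f' := map_poly (map_poly i') C.
have fE : f = \prod_(r <- rs) ('X - (Y i r)%:P) by exact: CE.
have fE' : f' = \prod_(r <- [seq Y i' r | r <- rs']) ('X - r%:P).
  by rewrite big_map; exact: CE.
have ff' k : gauss w f`_k = gauss w' f'`_k.
  rewrite /f /f' !coef_map /=.
  by rewrite (gauss_map_eq _ ww') /gauss size_map_poly; apply: eq_bigr => l _; rewrite coef_map.
have /(@gauss_prod_XsubC _ _ w')[f0 flt] :
    forall y, y \in [seq Y i' r | r <- rs'] -> ltv (gauss w' y) (Some 0).
  move=> _ /mapP[r rrs ->].
  have rlt : (index r rs' < size rs')%N by rewrite index_mem.
  apply: lev_ltv_trans (gauss_le _ _ (index r rs')) _.
  by rewrite YE rlt nth_index //; have [] := PP r rrs.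
rewrite -fE' in f0 flt.
have {}f0 : f`_0 != 0.
  apply/eqP => f0'; have := ff' 0%N; rewrite f0' gauss0.
  by have [g ->] := gauss_fin w' f0.
have [g fg] := gauss_fin w f0.
have {}flt k : ltv (Some g) (gauss w f`_k.+1) by rewrite -fg !ff'.
(* The contradiction: a Gauss-integral root would express the constant coefficient of [f] through
   terms of strictly greater value. *)
have : f.[Y i u] = 0.
  have urs : u \in rs by rewrite -root_prod_XsubC -rsE.
  by apply/eqP; rewrite fE -rootE -(big_map (Y i) xpredT (fun y => 'X - y%:P)) root_prod_XsubC map_f.
rewrite horner_coef; case E: (size f) => [|n].
  by move: f0; rewrite nth_default ?E ?eqxx.
rewrite big_ord_recl /= expr0 mulr1 => /eqP; rewrite addr_eq0 => /eqP f0E.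
have : ltv (Some g) (gauss w f`_0); last by rewrite fg /ltv levv.
rewrite f0E gaussN; elim/big_ind: _ => [|x y|k _]; first by rewrite gauss0.
  exact: ltv_gaussD.
rewrite gaussM -[Some g]addv0; apply: ltv_addv; rewrite ?flt //.
exact: gaussX_ge0.
Qed.

End IsometricExtension.

Section IsometricGraphs.
Variables (L : closedFieldType) (G : orderedZmodType) (w w' : valuation L G).

Definition isometric_graph (S : set (L * L)) : Prop :=
  is_morphism_graph S /\ forall x y, S (x, y) -> w x = w' y.

(** Vanishing means having infinite value, so equality of values alone makes the assignment of
    [q(u')] to [q(u)] well defined and injective on F(u). *)
Lemma generated_graph (F : fieldType) (i i' : {rmorphism F -> L}) (u u' : L)
    (p : {poly F}) : is_minpoly i u p ->
  (forall q, w (map_poly i q).[u] = w' (map_poly i' q).[u']) ->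
  isometric_graph [set z | exists q, z = ((map_poly i q).[u], (map_poly i' q).[u'])].
Proof.
move=> pu ww'.
have eq0 q : ((map_poly i q).[u] == 0) = ((map_poly i' q).[u'] == 0).
  apply/eqP/eqP => q0; first by apply/(vfun_eqoo w' _).1; rewrite -ww' q0 vfun0.
  by apply/(vfun_eqoo w _).1; rewrite ww' q0 vfun0.
split; last by move=> x y [q [-> ->]].
split=> [|_ _ [q ->] [r ->]|_ _ [q ->] [r ->]|_ [q ->]|_ [q ->]] /=.
- by exists 1; rewrite !rmorph1 !hornerE.
- by exists (q - r); rewrite !rmorphB !hornerE.
- by exists (q * r); rewrite !rmorphM !hornerE.
- have [q0|q0] := eqVneq (map_poly i q).[u] 0.
    by exists 0; move: (q0) => /eqP; rewrite eq0 => /eqP ->; rewrite q0 !rmorph0 !horner0 invr0.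
  have [r pr] := minpoly_inv pu q0; exists r.
  have [E E'] : (map_poly i (q * r - 1)).[u] = 0 /\ (map_poly i' (q * r - 1)).[u'] = 0.
    move: pr; rewrite -(minpoly_rootE _ pu) rootE => E; split; first exact/eqP.
    by apply/eqP; rewrite -eq0.
  move: E E'; rewrite !rmorphB !rmorphM !rmorph1 !hornerE => /eqP + /eqP.
  rewrite !subr_eq0 => /eqP E /eqP E'.
  have q0' : (map_poly i' q).[u'] != 0 by rewrite -eq0.
  congr (_, _); first by rewrite -[LHS]mulr1 -E mulKf.
  by rewrite -[LHS]mulr1 -E' mulKf.
- exact: eq0.
Qed.

Lemma algebraicOver_sub (F F' : fieldType) (i : {rmorphism F -> L})
    (j : {rmorphism F' -> L}) z : range i `<=` range j ->
  algebraicOver i z -> algebraicOver j z.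
Proof.
move=> ij [p p0 rp].
have /choice[f fE] : forall c, exists d, j d = i c.
  by move=> c; have [d _ <-] := ij (i c) (ex_intro2 _ _ c I erefl); exists d.
have fpE : map_poly j (\poly_(k < size p) f p`_k) = map_poly i p.
  apply/polyP => k; rewrite !coef_map coef_poly; case: ltnP => pk /=.
    exact: fE.
  by rewrite nth_default // !rmorph0.
exists (\poly_(k < size p) f p`_k); last by rewrite fpE.
by rewrite -(map_poly_eq0 j) fpE map_poly_eq0.
Qed.

Theorem isometric_extension (F : fieldType) (i i' : {rmorphism F -> L}) :
  (forall z, algebraicOver i z) -> (forall c, w (i c) = w' (i' c)) ->
  exists s : {rmorphism L -> L},
    (forall c, s (i c) = i' c) /\ forall z, w' (s z) = w z.
Proof.
move=> algi ww'.
pose base := [set z | exists c, z = (i c, i' c)].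
pose P A := A = set0 \/ (isometric_graph A /\ base `<=` A).
have baseP : P base.
  right; split=> //; split; last by move=> x y [c [-> ->]].
  split=> [|_ _ [c ->] [d ->]|_ _ [c ->] [d ->]|_ [c ->]|_ [c ->]] /=.
  - by exists 1; rewrite !rmorph1.
  - by exists (c - d); rewrite !rmorphB.
  - by exists (c * d); rewrite !rmorphM.
  - by exists (c^-1); rewrite !fmorphV.
  - by rewrite !fmorph_eq0.
have [|A [[A0|[[AG AI] bA]] Amax]] := @Zorn_bigcup _ P.
- move=> C CP Ctot.
  have [[B [CB [b Bb]]]|CN] := pselect (exists B, C B /\ exists b, B b); last first.
    left; apply/seteqP; split=> // z [B CB Bz]; apply: CN; exists B; split=> //.
    by exists z.
  have good D d : C D -> D d -> isometric_graph D /\ base `<=` D.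
    by move=> /CP[->|//].
  right; split; last first.
    by move=> z bz; exists B => //; have [_] := good _ _ CB Bb; apply.
  have common p q : (\bigcup_(X in C) X) p -> (\bigcup_(X in C) X) q ->
      exists D, [/\ C D, D p & D q].
    move=> [D CD Dp] [E CE Eq]; have [DE|ED] := Ctot _ _ CD CE.
      by exists E; split=> //; exact: DE.
    by exists D; split=> //; exact: ED.
  split; last by move=> x y [D CD Dxy]; have [[_ DI] _] := good _ _ CD Dxy; exact: DI.
  split=> [|p q Cp Cq|p q Cp Cq|p [D CD Dp]|p [D CD Dp]].
  - by exists B => //; have [[[]]] := good _ _ CB Bb.
  - have [D [CD Dp Dq]] := common _ _ Cp Cq; exists D => //.
    by have [[[_ DB _ _ _] _] _] := good _ _ CD Dp; exact: DB.
  - have [D [CD Dp Dq]] := common _ _ Cp Cq; exists D => //.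
    by have [[[_ _ DM _ _] _] _] := good _ _ CD Dp; exact: DM.
  - exists D => //.
    by have [[[_ _ _ DV _] _] _] := good _ _ CD Dp; exact: DV.
  - by have [[[_ _ _ _ D0] _] _] := good _ _ CD Dp; exact: D0.
- case: (Amax base) => //; rewrite A0; split; last by move=> /(_ (i 0, i' 0)); apply; exists 0.
  by move=> z.
have full u : exists u', A (u, u').
  apply: contrapT => uN.
  have [E [j [j' AE]]] := morphism_graph_field AG.
  have jj' c : w (j c) = w' (j' c) by apply: AI; apply/AE; exists c.
  have ij : range i `<=` range j.
    move=> _ [c _ <-]; have /bA/AE[d [<- _]] : base (i c, i' c) by exists c.
    by exists d.
  have [p pu] := minpoly_ex (algebraicOver_sub ij (algi u)).
  have [u' ru' uu'] := isometric_root jj' pu.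
  pose B := [set z | exists q, z = ((map_poly j q).[u], (map_poly j' q).[u'])].
  have AB : A `<=` B.
    move=> [x y] /AE[z [<- <-]]; exists z%:P.
    by rewrite !map_polyC !hornerC.
  have Bu : B (u, u') by exists 'X; rewrite !map_polyX !hornerX.
  case: (Amax B).
    by split=> // BA; apply: uN; exists u'; exact: BA.
  right; split; last exact: subset_trans bA AB.
  exact: generated_graph pu uu'.
have [s sA] := choice full.
have [A1 AB AM AV A0] := AG.
have Afun x y y' : A (x, y) -> A (x, y') -> y = y'.
  move=> Axy Axy'; have := A0 _ (AB _ _ Axy Axy'); rewrite /= subrr eqxx.
  by move=> /esym; rewrite subr_eq0 => /eqP.
have szm : zmod_morphism s.
  by move=> x y; apply: Afun (sA _) _; exact: AB (sA x) (sA y).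
have smm : monoid_morphism s.
  split; first exact: Afun (sA _) A1.
  by move=> x y; apply: Afun (sA _) _; exact: AM (sA x) (sA y).
pose t : {rmorphism L -> L} := HB.pack s (GRing.isZmodMorphism.Build _ _ s szm)
  (GRing.isMonoidMorphism.Build _ _ s smm).
exists t; split=> [c|z]; last exact/esym/AI/sA.
by apply: Afun (sA _) _; apply: bA; exists c.
Qed.

Lemma isometric_extension_root (F : fieldType) (i i' : {rmorphism F -> L})
    (u u' : L) (p : {poly F}) :
  (forall z, algebraicOver i z) -> is_minpoly i u p ->
  (forall q, w (map_poly i q).[u] = w' (map_poly i' q).[u']) ->
  exists s : {rmorphism L -> L},
    [/\ forall c, s (i c) = i' c, s u = u' & forall z, w' (s z) = w z].
Proof.
move=> algi pu uu'.
have [/morphism_graph_field[E [j [j' SE]]] SI] := generated_graph pu uu'.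
have iS c : exists z, j z = i c /\ j' z = i' c.
  by apply/SE; exists c%:P; rewrite !map_polyC !hornerC.
have [z [zu zu']] : exists z, j z = u /\ j' z = u'.
  by apply/SE; exists 'X; rewrite !map_polyX !hornerX.
have [|c|s [sj sI]] := @isometric_extension _ j j'.
- move=> y; apply: algebraicOver_sub (algi y) => _ [c _ <-].
  by have [d [<- _]] := iS c; exists d.
- by apply: SI; apply/SE; exists c.
exists s; split=> [c||//]; last by rewrite -zu sj.
by have [d [<- <-]] := iS c; rewrite sj.
Qed.

End IsometricGraphs.

(** * Conjugates and orbits of algebraic elements *)

Section Conjugates.
Variables (F : fieldType) (L : closedFieldType) (i : {rmorphism F -> L}).
Hypothesis algi : forall z, algebraicOver i z.

Lemma minpoly_root_minpoly u u' p : is_minpoly i u p -> root (map_poly i p) u' ->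
  is_minpoly i u' p.
Proof. by case. Qed.

(** Ordinary extension of embeddings is the isometric one for the trivial valuation with values in
    [G]. *)
Lemma conjugate_ex (G : orderedZmodType) u u' p :
  is_minpoly i u p -> root (map_poly i p) u' ->
  exists s : {rmorphism L -> L}, (forall c, s (i c) = i c) /\ s u = u'.
Proof.
move=> pu ru'; have pu' := minpoly_root_minpoly pu ru'.
have [|s [si su _]] := @isometric_extension_root L G (trivial_valuation L G)
  (trivial_valuation L G) F i i u u' p algi pu; last by exists s.
by move=> q; rewrite !trivial_valuationE -!rootE (minpoly_rootE _ pu) (minpoly_rootE _ pu').
Qed.

Variable s : {rmorphism L -> L}.
Hypothesis si : forall c, s (i c) = i c.

Lemma map_fixed_poly (p : {poly F}) : map_poly s (map_poly i p) = map_poly i p.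
Proof. by rewrite -map_poly_comp; apply: eq_map_poly => c; exact: si. Qed.

Lemma fixed_root p u : root (map_poly i p) u -> root (map_poly i p) (s u).
Proof. by rewrite -{2}(map_fixed_poly p) fmorph_root. Qed.

Lemma finite_conjugates u :
  exists2 rs : seq L, u \in rs & forall x, x \in rs -> s x \in rs.
Proof.
have [p p0 rp] := algi u.
have [rs rsE] := closed_field_poly_normal (map_poly i p).
have l0 : lead_coef (map_poly i p) != 0 by rewrite lead_coef_eq0 map_poly_eq0.
have rrs x : root (map_poly i p) x = (x \in rs).
  by rewrite rsE rootZ // root_prod_XsubC.
by exists rs => [|x]; rewrite -!rrs //; exact: fixed_root.
Qed.

Lemma algebraic_endo_bij : bijective s.
Proof.
have sinj : injective s := fmorph_inj s.
have /choice[t tK] : forall z, exists x, s x = z.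
  move=> z; have [rs zrs srs] := finite_conjugates z.
  have us : uniq (map s (undup rs)) by rewrite map_inj_uniq // undup_uniq.
  have sub : {subset map s (undup rs) <= undup rs}.
    by move=> _ /mapP[x + ->]; rewrite !mem_undup => /srs.
  have [|_ /(_ z)] := uniq_min_size us sub; first by rewrite size_map.
  by rewrite mem_undup zrs => /mapP[x _ ->]; exists x.
by exists t => x //; apply: sinj; rewrite tK.
Qed.

Lemma finite_orbit u : exists2 n, (0 < n)%N & iter n s u = u.
Proof.
have sinj : injective s := fmorph_inj s.
have [rs urs srs] := finite_conjugates u.
have lo : looping s u (size rs).
  apply/negPn; rewrite -looping_uniq; apply/negP => tu.
  suff : (size (traject s u (size rs).+1) <= size rs)%N by rewrite size_traject ltnn.
  apply: uniq_leq_size tu _ => _ /trajectP[k _ ->].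
  by elim: k => [|k IHk] //=; exact: srs.
have /trajectP[k kn kE] := lo; exists (size rs - k)%N; first by rewrite subn_gt0.
have iter_inj m : injective (iter m s).
  by elim: m => [|m IHm] x y //= /sinj /IHm.
by apply: (iter_inj k); rewrite -iterD subnKC // ltnW.
Qed.

End Conjugates.

(** * Newton polygons with one slope *)

Lemma addv_mulrS (G : orderedZmodType) (g : G) n :
  Some (g *+ n.+1) = addv (Some g) (Some (g *+ n)).
Proof. by rewrite /addv mulrS. Qed.

Section OneSlope.
Variables (L : fieldType) (G : orderedZmodType).

Lemma coef_mul_XsubC (x : L) f k :
  (('X - x%:P) * f)`_k = (if k is k'.+1 then f`_k' else 0) - x * f`_k.
Proof. by rewrite mulrBl coefB coefXM coefCM; case: k. Qed.

Lemma lev_prod_XsubC (w : valuation L G) (g : G) (rs : seq L) k :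
  (forall r, r \in rs -> lev (Some g) (w r)) ->
  lev (Some (g *+ (size rs - k))) (w (\prod_(r <- rs) ('X - r%:P))`_k).
Proof.
elim: rs k => [|r rs IHrs] k gr.
  rewrite big_nil coef1; case: k => [|k] /=; first by rewrite vfun1 /= lexx.
  by rewrite vfun0.
rewrite big_cons coef_mul_XsubC.
have {}IHrs l : lev (Some (g *+ (size rs - l))) (w (\prod_(r <- rs) ('X - r%:P))`_l).
  by apply: IHrs => x xrs; apply: gr; rewrite inE xrs orbT.
apply: lev_vfunB; first by case: k => [|k]; rewrite ?vfun0 ?levoo //=; exact: IHrs.
have [ks|sk] := leqP k (size rs); last first.
  by rewrite nth_default ?mulr0 ?vfun0 ?levoo // size_prod_XsubC.
have -> : (size (r :: rs) - k = (size rs - k).+1)%N by rewrite /= subSn.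
rewrite vfunM addv_mulrS.
by apply: lev_addv; [apply: gr; rewrite inE eqxx | exact: IHrs].
Qed.

Lemma prod_XsubC_coef0 (rs : seq L) :
  (\prod_(r <- rs) ('X - r%:P))`_0 = \prod_(r <- rs) (- r).
Proof.
rewrite -horner_coef0 horner_prod; apply: eq_bigr => r _.
by rewrite !hornerE.
Qed.

Lemma lev_vprod (w : valuation L G) (g : G) (rs : seq L) :
  (forall r, r \in rs -> lev (Some g) (w r)) ->
  lev (Some (g *+ size rs)) (w (\prod_(r <- rs) (- r))).
Proof.
by move=> gr; have := @lev_prod_XsubC w g rs 0 gr; rewrite subn0 prod_XsubC_coef0.
Qed.

(** The coefficients, on which [w] and [w'] agree, bound the polygon from below by a segment of
    slope given by [g]. A root of smaller [w']-value would make the leading term strictly dominant;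
    a root of greater [w']-value would make the value of the constant coefficient too large. *)
Lemma one_slope (w w' : valuation L G) (g : G) (rs : seq L)
    (f := \prod_(r <- rs) ('X - r%:P)) :
  (forall r, r \in rs -> w r = Some g) -> (forall k, w' f`_k = w f`_k) ->
  forall r, r \in rs -> w' r = Some g.
Proof.
move=> wr ww'; have ler r : r \in rs -> lev (Some g) (w r).
  by move=> /wr ->; rewrite levv.
have ler' r : r \in rs -> lev (Some g) (w' r).
  move=> rrs; apply/negPn/negP => rg; have [h rh] := ltv_fin rg.
  rewrite rh /ltv /= -oag_ltNge in rg.
  have : f.[r] = 0 by apply/eqP; rewrite -rootE root_prod_XsubC.
  rewrite horner_coef size_prod_XsubC big_ord_recr /= => /eqP.
  have fl : f`_(size rs) = 1.
    by have /monicP := monic_prod_XsubC rs xpredT id; rewrite lead_coefE size_prod_XsubC.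
  rewrite fl mul1r addrC addr_eq0 => /eqP /(congr1 w').
  rewrite vfunN (vfunX _ rh) => E.
  suff : ltv (Some (h *+ size rs)) (Some (h *+ size rs)) by rewrite /ltv levv.
  rewrite {2}E; apply: ltv_vsum => k _; rewrite vfunM (vfunX _ rh) ww'.
  have : ltv (Some (h *+ size rs)) (addv (Some (g *+ (size rs - k))) (Some (h *+ k))).
    rewrite /addv /ltv /= -oag_ltNge -{1}(subnK (ltnW (ltn_ord k))) mulrnDr.
    by rewrite oag_ltr_leD // oag_ltrMn // subn_gt0.
  move=> /ltv_lev_trans; apply; apply: lev_addv; rewrite ?levv //.
  exact: lev_prod_XsubC.
move=> r rrs; apply: lev_anti; last exact: ler'.
apply/negPn/negP => gr.
have f0 : w f`_0 = Some (g *+ size rs).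
  rewrite prod_XsubC_coef0; elim: (rs) wr => [|x s IHs] wr.
    by rewrite big_nil vfun1.
  rewrite big_cons vfunM vfunN wr ?inE ?eqxx // IHs /addv /= ?mulrS // => y ys.
  by rewrite wr // inE ys orbT.
have := ww' 0%N; rewrite f0 prod_XsubC_coef0 (big_rem r) //= vfunM vfunN => E.
suff : ltv (Some (g *+ size rs)) (Some (g *+ size rs)) by rewrite /ltv levv.
rewrite -{2}E; have srs : size rs = (size (rem r rs)).+1.
  by rewrite size_rem //; case: (rs) rrs.
rewrite srs addv_mulrS; apply: ltv_addv => //.
by apply: lev_vprod => x /mem_rem /ler'.
Qed.

End OneSlope.

(** * Fixed fields of isometries are henselian *)

Section FixedFields.
Variables (F : fieldType) (L : closedFieldType) (G : orderedZmodType).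
Variables (i : {rmorphism F -> L}) (w : valuation L G) (s : {rmorphism L -> L}).
Hypothesis algi : forall z, algebraicOver i z.
Hypothesis si : forall c, s (i c) = i c.
Hypothesis ws : forall z, w (s z) = w z.

Definition fixed_field : set L := [set z | s z = z].

Lemma subfield_fixed : is_subfield fixed_field.
Proof.
split=> [|x y|x y]; rewrite /fixed_field /=; first exact: rmorph1.
  by move=> xx yy; rewrite rmorphB xx yy.
by move=> xx yy; rewrite fmorph_div xx yy.
Qed.

(** The orbit of [u] is finite and [s] rotates it, so the product of the corresponding linear
    factors has coefficients in the fixed field, while all its roots have the value of [u]: the
    one-slope situation. *)
Lemma henselian_fixed : henselian w fixed_field.
Proof.
move=> w' ww' u; have [->|u0] := eqVneq u 0; first by rewrite !vfun0.
have [n n0 nu] := finite_orbit algi si u.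
have [g ug] := vfun_neq0 w u0.
pose f := \prod_(r <- traject s u n) ('X - r%:P).
have perm : perm_eq (map s (traject s u n)) (traject s u n).
  have mapt m x : map s (traject s x m) = traject s (s x) m.
    by elim: m x => //= m IHm x; rewrite IHm.
  have := trajectS s u n; rewrite trajectSr nu mapt => E.
  by rewrite -(perm_cons u) -E perm_rcons.
have fs k : s f`_k = f`_k.
  have fE : f = \prod_(r <- map s (traject s u n)) ('X - r%:P).
    by rewrite (perm_big _ perm).
  rewrite -coef_map [in RHS]fE big_map rmorph_prod; congr (polyseq _)`_k.
  by apply: eq_bigr => r _; rewrite rmorphB /= map_polyX map_polyC.
rewrite ug; apply: (@one_slope _ _ w w' g (traject s u n)).
- move=> _ /trajectP[k _ ->]; rewrite -ug.
  by elim: k => [|k IHk] //=; rewrite ws.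
- by move=> k; apply: ww'; exact: fs.
- by apply/trajectP; exists 0%N.
Qed.

Lemma henselization_fixed (E : set L) : E `<=` fixed_field ->
  henselization w E `<=` fixed_field.
Proof.
move=> Es z; apply; split=> //; [exact: subfield_fixed | exact: henselian_fixed].
Qed.

End FixedFields.

(** * Functoriality of rational function fields *)

Section FractionMorphisms.

Lemma fracP (F : fieldType) (z : {fraction {poly F}}) :
  exists p q, q != 0 /\ z = FracField.tofrac p / FracField.tofrac q.
Proof.
have d0 : \d_(repr z) != 0 by exact: denom_ratioP.
exists (\n_(repr z)), (\d_(repr z)); split=> //.
by rewrite -repr_fracE mulfK // tofrac_eq0.
Qed.

Lemma tofrac_inj (F : fieldType) : injective (@FracField.tofrac {poly F}).
Proof. by move=> p q /eqP; rewrite tofrac_eq => /eqP. Qed.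

Section FracMap.
Variables (F E : fieldType) (f : {rmorphism F -> E}).

Lemma frac_map_zmod : zmod_morphism (frac_map f).
Proof.
move=> x y; have [p [q [q0 ->]]] := fracP x; have [r [s [s0 ->]]] := fracP y.
have fq0 : map_poly f q != 0 by rewrite map_poly_eq0.
have fs0 : map_poly f s != 0 by rewrite map_poly_eq0.
rewrite -mulNr -tofracN addf_div ?tofrac_eq0 // -!tofracM -tofracD.
rewrite !frac_mapE ?mulf_neq0 // -mulNr -tofracN addf_div ?tofrac_eq0 //.
by rewrite -!tofracM -tofracD !(rmorphD, rmorphM, rmorphN).
Qed.

Lemma frac_map_monoid : monoid_morphism (frac_map f).
Proof.
split=> [|x y].
  rewrite -[X in frac_map f X]divr1 -tofrac1 frac_mapE ?oner_neq0 // rmorph1.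
  by rewrite tofrac1 divr1.
have [p [q [q0 ->]]] := fracP x; have [r [s [s0 ->]]] := fracP y.
rewrite mulf_div -!tofracM !frac_mapE ?mulf_neq0 // mulf_div -!tofracM.
by rewrite !rmorphM.
Qed.

HB.instance Definition _ := GRing.isZmodMorphism.Build _ _ (frac_map f) frac_map_zmod.
HB.instance Definition _ := GRing.isMonoidMorphism.Build _ _ (frac_map f) frac_map_monoid.

Lemma frac_map_tofrac p :
  frac_map f (FracField.tofrac p) = FracField.tofrac (map_poly f p).
Proof.
rewrite -[X in frac_map f X]divr1 -tofrac1 frac_mapE ?oner_neq0 // rmorph1.
by rewrite tofrac1 divr1.
Qed.

Lemma frac_map_const c : frac_map f (frac_const c) = frac_const (f c).
Proof. by rewrite /frac_const frac_map_tofrac map_polyC. Qed.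

End FracMap.

Section FracConst.
Variable F : fieldType.

Lemma frac_const_zmod : zmod_morphism (@frac_const F).
Proof. by move=> x y; rewrite /frac_const polyCB tofracB. Qed.

Lemma frac_const_monoid : monoid_morphism (@frac_const F).
Proof. by split=> [|x y]; rewrite /frac_const ?polyCM ?tofracM // polyC1 tofrac1. Qed.

HB.instance Definition _ := GRing.isZmodMorphism.Build _ _ (@frac_const F) frac_const_zmod.
HB.instance Definition _ := GRing.isMonoidMorphism.Build _ _ (@frac_const F) frac_const_monoid.

Lemma tofrac_horner (p : {poly F}) :
  FracField.tofrac p = (map_poly (@frac_const F) p).[FracField.tofrac 'X].
Proof.
elim/poly_ind: p => [|p c IHp]; first by rewrite tofrac0 rmorph0 horner0.
rewrite tofracD tofracM IHp [map_poly _ (_ + _)]rmorphD rmorphM /=.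
by rewrite map_polyX map_polyC !hornerE.
Qed.

End FracConst.

Lemma frac_map_comp (F E M : fieldType) (f : {rmorphism F -> E})
    (g : {rmorphism E -> M}) (h : {rmorphism F -> M}) :
  (forall c, g (f c) = h c) -> forall z, frac_map g (frac_map f z) = frac_map h z.
Proof.
move=> gf z; have [p [q [q0 ->]]] := fracP z.
have gfE r : map_poly g (map_poly f r) = map_poly h r.
  by rewrite -map_poly_comp; apply: eq_map_poly => c; exact: gf.
rewrite (frac_mapE f p q0) (frac_mapE h p q0).
by rewrite (frac_mapE g (map_poly f p)) ?map_poly_eq0 // !gfE.
Qed.

End FractionMorphisms.

(** * Lifting isometries of constants to the closure of Kbar(x) *)

Section ImplicitConstants.
Variables (G : orderedZmodType) (K : fieldType) (Kbar Omega : closedFieldType).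
Variables (iota : {rmorphism K -> Kbar}).
Variables (j : {rmorphism {fraction {poly Kbar}} -> Omega}).
Hypothesis Kbar_closure : is_algebraic_closure iota.
Hypothesis Omega_closure : is_algebraic_closure j.
Variables (nubar : valuation Kbar G) (omegabar : valuation {fraction {poly Kbar}} G).
Variable W : valuation Omega G.
Hypothesis omegabar_nubar : extends_valuation (@frac_const Kbar) nubar omegabar.
Hypothesis W_omegabar : extends_valuation j omegabar W.

(** The lifted automorphisms fix K(x) only, so the finiteness of their orbits requires [Omega] to be
    algebraic over K(x) and not just over Kbar(x). *)
Lemma algebraic_over_rational_functions z :
  algebraicOver (j \o frac_map iota) z.
Proof.
have [p p0 rp] := Omega_closure z.
apply/integral_algebraic; apply: integral_root rp _; first by rewrite map_poly_eq0.
have const c : integralOver (j \o frac_map iota) (j (frac_const c)).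
  have /integral_algebraic[q qM rq] := Kbar_closure c.
  exists (map_poly (@frac_const K) q); first by rewrite map_monic.
  rewrite -map_poly_comp (eq_map_poly (_ : _ =1 (j \o @frac_const Kbar) \o iota)).
    by rewrite map_poly_comp fmorph_root.
  by move=> d /=; rewrite frac_map_const.
have X : integralOver (j \o frac_map iota) (j (FracField.tofrac 'X)).
  rewrite -(map_polyX iota) -frac_map_tofrac.
  exact: (integral_id (j \o frac_map iota)).
have pol q : integralOver (j \o frac_map iota) (j (FracField.tofrac q)).
  rewrite tofrac_horner -horner_map -map_poly_comp; apply: integral_horner X.
  by apply/integral_poly => k; rewrite coef_map; exact: const.
apply/integral_poly => k; rewrite coef_map.
have [q [r [r0 ->]]] := fracP p`_k.
have := integral_div (pol q) (pol r); rewrite -fmorph_div; exact.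
Qed.

Section Lift.
Variables (a : Kbar) (gamma : G).
Hypothesis a_gamma : is_monomial_valuation nubar omegabar a gamma.

Local Notation om p := (omegabar (FracField.tofrac p)).

Lemma monomial_levP s (c : {poly Kbar}) :
  lev s (om (c \Po ('X - a%:P))) <->
  forall k, lev s (addv (nubar c`_k) (Some (gamma *+ k))).
Proof.
rewrite a_gamma; split=> [/lev_bigminP sc k|sc]; last exact/lev_bigminP.
have [kc|ck] := ltnP k (size c); first exact: (sc (Ordinal kc)).
by rewrite nth_default // vfun0 levoo.
Qed.

Lemma monomial_XsubC : lev (Some gamma) (om ('X - a%:P)).
Proof.
rewrite -[X in om X]comp_polyX; apply/monomial_levP => k.
rewrite coefX; case: eqP => [->|_]; last by rewrite vfun0.
by rewrite vfun1 add0v levv.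
Qed.

(** Moving the centre by [d] of value at least [gamma] does not change the valuation. One inequality
    is enough: the other one follows by translating back with [- d]. *)
Lemma monomial_translate (d : Kbar) (e : {poly Kbar}) :
  lev (Some gamma) (nubar d) ->
  lev (om (e \Po ('X - a%:P))) (om (e \Po ('X - a%:P - d%:P))).
Proof.
move=> gd; rewrite [X in lev _ (om X)]comp_polyE.
have -> : FracField.tofrac (\sum_(k < size e) e`_k *: ('X - a%:P - d%:P) ^+ k) =
    \sum_(k < size e) frac_const e`_k * FracField.tofrac ('X - a%:P - d%:P) ^+ k.
  rewrite (big_morph _ (@tofracD _) (@tofrac0 _)); apply: eq_bigr => k _.
  by rewrite -mul_polyC tofracM tofracXn.
apply: lev_vsum => k _; rewrite vfunM omegabar_nubar.
apply: (lev_trans ((monomial_levP _ _).1 (levv _) k)).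
apply: lev_addv; rewrite ?levv //.
have gX : lev (Some gamma) (om ('X - a%:P - d%:P)).
  by rewrite tofracB lev_vfunB ?monomial_XsubC // [omegabar _]omegabar_nubar.
elim: (nat_of_ord k) => [|l IHl]; first by rewrite vfun1 levv.
by rewrite exprS vfunM addv_mulrS lev_addv.
Qed.

Variable s : {rmorphism Kbar -> Kbar}.
Hypothesis s_iota : forall c, s (iota c) = iota c.
Hypothesis s_nubar : forall z, nubar (s z) = nubar z.
Hypothesis sa : lev (Some gamma) (nubar (a - s a)).

(** [s] carries the monomial valuation centred at [a] to the one centred at [s a] with the same
    [gamma], and these coincide because the two centres are at distance at least [gamma] in
    value. *)
Lemma omegabar_frac_map z : omegabar (frac_map s z) = omegabar z.
Proof.
suff pol p : om (map_poly s p) = om p.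
  have [p [q [q0 ->]]] := fracP z; rewrite frac_mapE //.
  have [h qh] : exists h, om q = Some h by apply: vfun_neq0; rewrite tofrac_eq0.
  by rewrite !vfunM pol (vfunV qh) (vfunV (_ : om (map_poly s q) = Some h)) // pol.
pose c := p \Po ('X + a%:P).
have pE : p = c \Po ('X - a%:P).
  by rewrite /c -comp_polyA comp_polyD comp_polyX comp_polyC subrK comp_polyXr.
set e := map_poly s c; pose d := s a - a.
have gd : lev (Some gamma) (nubar d) by rewrite /d vfunBC.
have spE : map_poly s p = e \Po ('X - a%:P - d%:P).
  rewrite {1}pE map_comp_poly rmorphB /= map_polyX map_polyC; congr (_ \Po _).
  by rewrite /d polyCB opprB addrA subrK.
have eE : om (e \Po ('X - a%:P)) = om p.
  rewrite pE !a_gamma size_map_poly; apply: eq_bigr => k _.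
  by rewrite coef_map /= s_nubar.
apply: lev_anti; last by rewrite -eE spE; exact: monomial_translate.
rewrite spE -eE; pose e' := e \Po ('X - d%:P).
have e'E : e' \Po ('X - a%:P) = e \Po ('X - a%:P - d%:P).
  by rewrite /e' -comp_polyA comp_polyB comp_polyX comp_polyC.
have e'E' : e' \Po ('X - a%:P - (- d)%:P) = e \Po ('X - a%:P).
  by rewrite /e' -comp_polyA comp_polyB comp_polyX comp_polyC polyCN opprK addrK.
by rewrite -e'E -e'E' monomial_translate // vfunN.
Qed.

Lemma isometric_lift : exists t : {rmorphism Omega -> Omega},
  (forall y, t (j y) = j (frac_map s y)) /\ forall z, W (t z) = W z.
Proof.
have [//|y|t [tj tW]] := @isometric_extension _ _ W W _ j (j \o frac_map s).
  by rewrite /= !W_omegabar omegabar_frac_map.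
by exists t.
Qed.

Lemma implicit_constant_fixed z : implicit_constant_field iota j W z -> s z = z.
Proof.
have [t [tj tW]] := isometric_lift.
have tfix c : t ((j \o frac_map iota) c) = (j \o frac_map iota) c.
  by rewrite /= tj (frac_map_comp s_iota).
move/(henselization_fixed algebraic_over_rational_functions tfix tW).
rewrite /fixed_field /= tj frac_map_const => H.
have /H : range (j \o frac_map iota) `<=` fixed_field t by move=> _ [c _ <-].
by move=> /(fmorph_inj j) /tofrac_inj /polyC_inj.
Qed.

End Lift.

End ImplicitConstants.

(** * Simple, separable and purely inseparable extensions *)

Section PolynomialLifts.
Variables (F F' : fieldType) (L : fieldType).
Variables (i : {rmorphism F -> L}) (j : {rmorphism F' -> L}).

Lemma poly_lift (p : {poly L}) : (forall k, range i p`_k) ->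
  exists q, map_poly i q = p.
Proof.
move=> pi; have /choice[f fE] : forall k, exists c, i c = p`_k.
  by move=> k; have [c _ <-] := pi k; exists c.
exists (\poly_(k < size p) f k); apply/polyP => k; rewrite coef_map coef_poly /=.
by case: ltnP => pk; rewrite ?fE // nth_default // rmorph0.
Qed.

End PolynomialLifts.

Section SimpleExtensions.
Variables (F : fieldType) (L : closedFieldType) (i : {rmorphism F -> L}).

Lemma subfield_horner u p : is_minpoly i u p ->
  is_subfield [set (map_poly i q).[u] | q in setT].
Proof.
move=> pu; split=> [|_ _ [q _ <-] [r _ <-]|_ _ [q _ <-] [r _ <-]].
- by exists 1; rewrite // rmorph1 hornerE.
- by exists (q - r); rewrite // rmorphB !hornerE.
- have [r0|r0] := eqVneq (map_poly i r).[u] 0.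
    by exists 0; rewrite // rmorph0 horner0 r0 invr0 mulr0.
  have [s ps] := minpoly_inv pu r0; exists (q * s) => //.
  move: ps; rewrite -(minpoly_rootE _ pu) rootE rmorphB !rmorphM rmorph1 !hornerE.
  rewrite subr_eq0 => /eqP E; congr (_ * _).
  by apply: (mulfI r0); rewrite mulfV // -E.
Qed.

Lemma adjoin_algebraicE u p : is_minpoly i u p ->
  adjoin (range i) u = [set (map_poly i q).[u] | q in setT].
Proof.
move=> pu; apply/seteqP; split.
  apply: adjoin_min; first exact: subfield_horner pu.
    by move=> _ [c _ <-]; exists c%:P; rewrite // map_polyC hornerC.
  by exists 'X; rewrite // map_polyX hornerX.
move=> _ [q _ <-]; have sA := subfield_adjoin (range i) u.
rewrite horner_coef; apply: (subfield_sum _ sA) => k _.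
apply: (subfieldM sA); last exact: (subfieldX _ sA (mem_adjoin _ _)).
by rewrite coef_map; apply: sub_adjoin; exists (q`_k).
Qed.

Lemma minpoly_separable u p : is_minpoly i u p -> p^`() != 0 -> separable_poly p.
Proof.
case=> pM [p1 pI] rp p'0; rewrite separable_poly.unlock coprimep_def.
apply/negPn/negP => g1.
have := pI _ g1 (dvdp_gcdl _ _); rewrite /eqp => /andP[_ pg].
have /(dvdp_leq p'0) : p %| p^`() by rewrite (dvdp_trans pg) // dvdp_gcdr.
by rewrite leqNgt lt_size_deriv // monic_neq0.
Qed.

(** Choose [n] so that the minimal polynomial of the [l ^ n]-th power has least degree. If its
    derivative vanished, it would be a polynomial in ['X^l], and the next power of [u] would have
    smaller degree. *)
Lemma separable_power u : algebraicOver i u ->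
  (exists2 p, is_minpoly i u p & separable_poly p) \/
  exists2 l, l \in [pchar L] & exists n p,
    is_minpoly i (u ^+ (l ^ n)) p /\ separable_poly p.
Proof.
move=> algu; have [p0 p0u] := minpoly_ex algu; have [p0M [p01 _] _] := p0u.
have [p0'|/(minpoly_separable p0u)] := eqVneq p0^`() 0; last by left; exists p0.
have [l lF] : exists l, l \in [pchar F].
  apply: (@natf0_pchar F (size p0).-1); first by rewrite -subn1 subn_gt0.
  have := congr1 (fun q : {poly F} => q`_(size p0).-2) p0'.
  rewrite coef_deriv coef0 prednK; last by rewrite -subn1 subn_gt0.
  by rewrite -lead_coefE (monicP p0M) => ->.
have l0 : (0 < l)%N by have /andP[/prime_gt0] := lF.
right; exists l; first by rewrite (fmorph_pchar i).
pose Q m := `[< exists n p, is_minpoly i (u ^+ (l ^ n)) p /\ size p = m >].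
have exQ : exists m, Q m.
  by exists (size p0); apply/asboolP; exists 0%N, p0; rewrite expn0 expr1.
case: (ex_minnP exQ) => _ /asboolP[n [p [pu <-]]] pmin.
exists n, p; split=> //; apply: (minpoly_separable pu); apply/eqP => p'0.
have [pM [p1 _] rp] := pu.
have pk k : ~~ (l %| k)%N -> p`_k = 0.
  case: k => [|k]; first by rewrite dvdn0.
  rewrite (dvdn_pcharf lF) => k0; have := congr1 (fun q : {poly F} => q`_k) p'0.
  by rewrite coef_deriv coef0 -mulr_natr => /eqP; rewrite mulf_eq0 (negPf k0) orbF => /eqP.
pose g := \poly_(k < size p) p`_(k * l).
have pE : p = g \Po 'X^l.
  apply/polyP => k; rewrite coef_comp_poly_Xn // coef_poly.
  case: ifP => [/dvdnP[m ->]|/negbT/pk //]; rewrite mulnK //.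
  case: ltnP => // pm; rewrite nth_default // (leq_trans pm) //.
  by rewrite leq_pmulr.
have g0 : g != 0 by apply: contraTneq p1 => g0; rewrite pE g0 comp_poly0 size_poly0.
have gu : root (map_poly i g) (u ^+ (l ^ n.+1)).
  have : root (map_poly i p) (u ^+ (l ^ n)) by [].
  by rewrite pE map_comp_poly map_polyXn !rootE horner_comp hornerXn -exprM -expnSr.
have [q qu] : exists q, is_minpoly i (u ^+ (l ^ n.+1)) q by apply: minpoly_ex; exists g.
have /pmin : Q (size q) by apply/asboolP; exists n.+1, q.
have qg : (size q <= size g)%N by rewrite dvdp_leq // -(minpoly_rootE _ qu).
move/leq_trans/(_ qg); have := size_comp_poly g 'X^l; rewrite -pE size_polyXn /=.
have : (1 < l)%N by have /andP[/prime_gt1] := lF.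
have := size_poly_gt0 g; rewrite g0; move: p1.
case: (size p) => [|[|a]] //= _; case: (size g) => //= b _ l1 ab.
rewrite !ltnS ab leqNgt -{1}[b]muln1 ltn_pmul2l ?l1 //.
by case: b ab => //; rewrite mul0n.
Qed.

Lemma pchar_pow_inj l (x y : L) : l \in [pchar L] -> x ^+ l = y ^+ l -> x = y.
Proof.
move=> lL xy; apply/eqP; rewrite -subr_eq0; have : (x - y) ^+ l == 0.
  have := pFrobenius_autB_comm lL (mulrC x y); rewrite !pFrobenius_autE => ->.
  by rewrite xy subrr.
by rewrite expf_eq0 => /andP[].
Qed.

(* A separable extension contains no l-th root of a constant outside the base:
   if x = g(v) with deg g < deg p, then g - x vanishes at all conjugates of v. *)
Lemma separable_pchar_root l v p g c : l \in [pchar L] ->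
  is_minpoly i v p -> separable_poly p ->
  (map_poly i g).[v] ^+ l = i c -> range i (map_poly i g).[v].
Proof.
move=> lL pv psep gc; have [pM [p1 pI] rp] := pv.
set x := (map_poly i g).[v] in gc *.
pose h := g %% p.
have hv : (map_poly i h).[v] = x.
  rewrite /x [in RHS](divp_eq g p) rmorphD rmorphM /= !hornerE.
  by rewrite (rootP rp) mulr0 add0r.
have [rs rsE] : exists rs, map_poly i p = \prod_(r <- rs) ('X - r%:P).
  by apply: closed_monic_split; rewrite map_monic.
have rsu : uniq rs by rewrite -separable_prod_XsubC -rsE separable_map.
have srs : size p = (size rs).+1 by rewrite -(size_map_poly i) rsE size_prod_XsubC.
have pd : p %| h ^+ l - c%:P.
  rewrite -(minpoly_rootE _ pv) rootE rmorphB rmorphXn /= map_polyC !hornerE.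
  by rewrite hv gc subrr.
have hx : map_poly i h - x%:P = 0.
  apply/eqP/negPn/negP => hx0.
  have : (size rs < size (map_poly i h - x%:P)%R)%N.
    apply: max_poly_roots => //; apply/allP => r rrs.
    have rpr : root (map_poly i p) r by rewrite rsE root_prod_XsubC.
    have : root (map_poly i (h ^+ l - c%:P)) r.
      by have /dvdpP[q ->] := pd; rewrite rmorphM rootM rpr orbT.
    rewrite rootE rmorphB rmorphXn /= map_polyC !hornerE subr_eq0 => /eqP hr.
    rewrite rootE !hornerE subr_eq0; apply/eqP/(pchar_pow_inj lL).
    exact: etrans hr (esym gc).
  apply/negP; rewrite -leqNgt -ltnS -srs (leq_ltn_trans (size_polyD _ _)) //.
  rewrite size_polyN gtn_max size_map_poly ltn_modp monic_neq0 //=.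
  exact: leq_ltn_trans (size_polyC_leq1 _) p1.
move/eqP: hx; rewrite subr_eq0 => /eqP hx; exists h`_0 => //.
by rewrite -coef_map hx coefC.
Qed.

End SimpleExtensions.

Section PurelyInseparable.
Variables (F : fieldType) (L : closedFieldType) (i : {rmorphism F -> L}).
Hypothesis algi : forall z, algebraicOver i z.

(* By maximality of M, the separable closure of M in L is M: every element of L
   has a power in M, which determines its value. *)
Lemma henselian_avoiding (G : orderedZmodType) (w : valuation L G) l x :
  l \in [pchar L] -> ~ range i x -> range i (x ^+ l) ->
  ~ henselization w (range i) x.
Proof.
move=> lL xN xl.
pose P (A : set L) := A = set0 \/ [/\ is_subfield A, range i `<=` A & ~ A x].
have Pi : P (range i) by right; split=> //; exact: subfield_range.
have [|M [[M0|[sM iM Mx]] Mmax]] := @Zorn_bigcup _ P.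
- move=> C CP Ctot.
  have [[B [CB [b Bb]]]|CN] := pselect (exists B, C B /\ exists b, B b); last first.
    left; apply/seteqP; split=> // z [B CB Bz]; apply: CN; exists B; split=> //.
    by exists z.
  have good D d : C D -> D d -> [/\ is_subfield D, range i `<=` D & ~ D x].
    by move=> /CP[->|//].
  have common p q : (\bigcup_(X in C) X) p -> (\bigcup_(X in C) X) q ->
      exists D, [/\ C D, D p & D q].
    move=> [D CD Dp] [E CE Eq]; have [DE|ED] := Ctot _ _ CD CE.
      by exists E; split=> //; exact: DE.
    by exists D; split=> //; exact: ED.
  right; split; last 2 first.
  + by move=> z iz; exists B => //; have [_ iB _] := good _ _ CB Bb; exact: iB.
  + by move=> [D CD Dx]; have [_ _ DN] := good _ _ CD Dx; exact: DN.
  split=> [|y z Cy Cz|y z Cy Cz].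
  + by exists B => //; have [[]] := good _ _ CB Bb.
  + have [D [CD Dy Dz]] := common _ _ Cy Cz; exists D => //.
    by have [[_ DB _] _ _] := good _ _ CD Dy; exact: DB.
  + have [D [CD Dy Dz]] := common _ _ Cy Cz; exists D => //.
    by have [[_ _ DV] _ _] := good _ _ CD Dy; exact: DV.
- case: (Mmax (range i)) => //; rewrite M0; split=> // /(_ (i 0)).
  by apply; exists 0.
have [E [k kM]] := subfield_field sM.
have algk z : algebraicOver k z by apply: algebraicOver_sub (algi z); rewrite kM.

have [d _ kd] : range k (x ^+ l) by rewrite kM; exact: iM.
(* If [v] were outside [M], maximality would put [x] into M(v), a separable simple extension, which
   contains no new [l]-th root of an element of [M]. *)
have sepM v p : is_minpoly k v p -> separable_poly p -> M v.
  move=> pv psep; apply: contrapT => Mv.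
  have : adjoin (range k) v x.
    apply: contrapT => xA; apply: (Mmax (adjoin (range k) v)).
      split; first by rewrite -{1}kM; exact: sub_adjoin.
      by move=> /(_ v (mem_adjoin _ _)).
    right; split=> //; first exact: subfield_adjoin.
    by rewrite kM; apply: subset_trans iM _; exact: sub_adjoin.
  rewrite (adjoin_algebraicE pv) => -[g _ gx]; apply: Mx.
  by rewrite -kM -gx; apply: (separable_pchar_root (c := d) lL pv psep); rewrite gx kd.
have power u : exists2 n, (0 < n)%N & M (u ^+ n).
  have [[p pu psep]|[q qL [n [p [pu psep]]]]] := separable_power (algk u).
    by exists 1%N => //; exact: sepM pu psep.
  exists (q ^ n)%N; last exact: sepM pu psep.
  by rewrite expn_gt0; have /andP[/prime_gt0 ->] := qL.
have hM : henselian w M.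
  move=> w' ww' u; have [->|u0] := eqVneq u 0; first by rewrite !vfun0.
  have [n n0 Mu] := power u; have := ww' _ Mu.
  have [g ug] := vfun_neq0 w u0; have [g' ug'] := vfun_neq0 w' u0.
  rewrite (vfunX _ ug) (vfunX _ ug') ug ug' => -[/(oag_mulrIn n0) ->] //.
by move=> /(_ M); rewrite /mkset => H; apply: Mx; apply: H; split.
Qed.

End PurelyInseparable.

Lemma henselian_invariant (F : fieldType) (L : closedFieldType)
    (G : orderedZmodType) (i : {rmorphism F -> L}) (w : valuation L G)
    (s : {rmorphism L -> L}) :
  henselian w (range i) -> (forall c, s (i c) = i c) -> forall z, w (s z) = w z.
Proof.
move=> hw si z; rewrite -comp_valuationE; apply: hw => _ [c _ <-].
by rewrite comp_valuationE si.
Qed.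

Lemma subfield_henselization (L : closedFieldType) (G : orderedZmodType)
  (w : valuation L G) F : is_subfield (henselization w F).
Proof. by apply: subfield_bigcap => H []. Qed.

Lemma sub_henselization (L : closedFieldType) (G : orderedZmodType)
  (w : valuation L G) F : F `<=` henselization w F.
Proof. by move=> z Fz H [_ FH _]; exact: FH. Qed.

Lemma separable_conjugate (F : fieldType) (L : closedFieldType)
    (i : {rmorphism F -> L}) u p : is_minpoly i u p -> separable_poly p ->
  ~ range i u -> exists2 u', root (map_poly i p) u' & u' != u.
Proof.
move=> pu psep uN; have [pM [p1 _] rp] := pu.
have [rs rsE] : exists rs, map_poly i p = \prod_(r <- rs) ('X - r%:P).
  by apply: closed_monic_split; rewrite map_monic.
have rsu : uniq rs by rewrite -separable_prod_XsubC -rsE separable_map.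
have srs : size p = (size rs).+1 by rewrite -(size_map_poly i) rsE size_prod_XsubC.
have rrs r : root (map_poly i p) r = (r \in rs) by rewrite rsE root_prod_XsubC.
have [/hasP[u' u'rs u'u]|/hasPn all_u] := boolP (has (fun r => r != u) rs).
  by exists u'; rewrite ?rrs.
case: uN; have rs1 : rs = [:: u].
  move: rsu all_u p1; rewrite srs; case: (rs) => [//|r [|r' t]] /=.
    by move=> _ /(_ r); rewrite inE eqxx negbK => /(_ isT)/eqP ->.
  move=> /andP[rN _] all_u _; move: rN.
  have /eqP -> : r == u by have := all_u r; rewrite inE eqxx negbK; exact.
  have /eqP -> : r' == u by have := all_u r'; rewrite !inE eqxx orbT negbK; exact.
  by rewrite inE eqxx.
exists (- p`_0) => //; rewrite rmorphN -coef_map rsE rs1 big_seq1 coefB coefX coefC.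
by rewrite sub0r opprK.
Qed.

(** * The Krasner constant *)

Section Kras.
Variables (K : fieldType) (Kbar : closedFieldType) (G : orderedZmodType).
Variables (iota : {rmorphism K -> Kbar}) (nubar : valuation Kbar G).
Hypothesis Kbar_closure : is_algebraic_closure iota.

Lemma galois_of_fix (s : {rmorphism Kbar -> Kbar}) :
  (forall c, s (iota c) = iota c) -> in_galois iota s.
Proof. by move=> si; split=> //; exact (algebraic_endo_bij Kbar_closure si). Qed.

Lemma galois_conjugate u u' p : is_minpoly iota u p -> root (map_poly iota p) u' ->
  exists2 s, in_galois iota s & s u = u'.
Proof.
move=> pu ru'; have [s [si su]] := conjugate_ex Kbar_closure G pu ru'.
by exists s => //; exact: galois_of_fix.
Qed.

Lemma max_value (l : seq (option G)) : l != [::] ->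
  exists2 m, m \in l & forall t, t \in l -> lev t m.
Proof.
elim: l => // s l IHl _; have [->|/IHl[m ml mmax]] := eqVneq l [::].
  by exists s => [|t]; rewrite inE // => /eqP ->; rewrite levv.
have [sm|ms] := orP (lev_total s m).
  by exists m => [|t]; rewrite inE ?ml ?orbT // => /predU1P[->//|/mmax].
exists s => [|t]; rewrite inE ?eqxx // => /predU1P[->|/mmax tm]; first exact: levv.
exact: lev_trans tm ms.
Qed.

(** The differences in question are differences of roots of the minimal polynomial, so the maximum
    runs over a finite list. Separability and [a] outside [K] provide a second root, which makes the
    list nonempty. *)
Lemma krasP a : separable_over iota a -> ~ range iota a ->
  is_kras iota nubar a (kras iota nubar a).
Proof.
case=> p pa psep aN; apply: xgetPex.
have [b rb ba] := separable_conjugate pa psep aN.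
have [_ _ ra] := pa.
have [rs rsE] : exists rs, map_poly iota p = \prod_(r <- rs) ('X - r%:P).
  by apply: closed_monic_split; rewrite map_monic; case: pa.
have rrs r : root (map_poly iota p) r = (r \in rs) by rewrite rsE root_prod_XsubC.
pose l := [seq nubar (z.1 - z.2) | z <- [seq (r, t) | r <- rs, t <- rs] & z.1 != z.2].
have memlP r t : r \in rs -> t \in rs -> r != t -> nubar (r - t) \in l.
  move=> rr tt rt; apply/mapP; exists (r, t) => //; rewrite mem_filter rt /=.
  by apply/allpairsP; exists (r, t).
have [|m ml mmax] := @max_value l.
  apply/eqP => l0; have := memlP b a; rewrite l0 in_nil -!rrs.
  by move=> /(_ rb ra ba).
have [[r t]] := mapP ml; rewrite mem_filter /= => /andP[rt /allpairsP[[r' t']]].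
move=> [/= rr tt [Er Et]]; rewrite -{}Er -{}Et {r' t'} in rr tt => mE.
have [g rtg] : exists g, nubar (r - t) = Some g by apply: vfun_neq0; rewrite subr_eq0.
rewrite -!rrs in rr tt; exists g; split.
  have [s sG sa] := galois_conjugate pa rr; have [s' sG' sa'] := galois_conjugate pa tt.
  by exists s, s'; rewrite sa sa'.
move=> s s' [_ si] [_ si'] /eqP ss'; rewrite -rtg -mE; apply: mmax.
by apply: memlP => //; rewrite -rrs; exact: fixed_root.
Qed.

End Kras.

(** * The implicit constant field compared with henselian fields *)

Section ImplicitConstantField.
Variables (G : orderedZmodType) (K : fieldType) (Kbar Omega : closedFieldType).
Variables (iota : {rmorphism K -> Kbar}).
Variables (j : {rmorphism {fraction {poly Kbar}} -> Omega}).
Hypothesis Kbar_closure : is_algebraic_closure iota.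
Hypothesis Omega_closure : is_algebraic_closure j.
Variables (nubar : valuation Kbar G) (omegabar : valuation {fraction {poly Kbar}} G).
Variable W : valuation Omega G.
Hypothesis omegabar_nubar : extends_valuation (@frac_const Kbar) nubar omegabar.
Hypothesis W_omegabar : extends_valuation j omegabar W.

Let kappa : {rmorphism Kbar -> Omega} := j \o @frac_const Kbar.

Let kappaW z : W (kappa z) = nubar z.
Proof. by rewrite /kappa /= W_omegabar omegabar_nubar. Qed.

Let Kx : set Omega := range (j \o frac_map iota).

Lemma kappa_base c : Kx (kappa (iota c)).
Proof. by exists (frac_const c); rewrite // /= frac_map_const. Qed.

Lemma sub_frac_range (E : fieldType) (f : {rmorphism E -> Kbar}) :
  range iota `<=` range f -> Kx `<=` range (j \o frac_map f).
Proof.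
move=> sub _ [z _ <-].
have lift p : exists q, map_poly f q = map_poly iota p.
  by apply: poly_lift => k; apply: sub; rewrite coef_map; exists (p`_k).
have [p [q [q0 ->]]] := fracP z; have [p' pE] := lift p; have [q' qE] := lift q.
have q'0 : q' != 0 by rewrite -(map_poly_eq0 f) qE map_poly_eq0.
exists (FracField.tofrac p' / FracField.tofrac q') => //=.
by rewrite !frac_mapE // pE qE.
Qed.

(** If the constant [z] equals p/q, it is the quotient of the coefficients of [p] and [q] at the
    degree of [q]. *)
Lemma kappa_frac_range (E : fieldType) (f : {rmorphism E -> Kbar}) z :
  range (j \o frac_map f) (kappa z) -> range f z.
Proof.
move=> [y _] /= /(fmorph_inj j); have [p [q [q0 ->]]] := fracP y.
have fq0 : map_poly f q != 0 by rewrite map_poly_eq0.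
rewrite frac_mapE // => /eqP; rewrite eq_sym -[X in X == _]divr1 eqr_div ?oner_neq0 ?tofrac_eq0 //.
rewrite mulr1 -tofracM tofrac_eq => /eqP E0.
have := congr1 (fun r : {poly Kbar} => r`_(size q).-1) E0.
rewrite /= coefCM !coef_map /= -lead_coefE => E1.
exists (p`_(size q).-1 / lead_coef q) => //.
by rewrite fmorph_div -E1 mulfK // fmorph_eq0 lead_coef_eq0.
Qed.

Let algKx := algebraic_over_rational_functions Kbar_closure Omega_closure.

Section Upper.
Variables (a : Kbar) (gamma : G).
Hypothesis a_gamma : is_monomial_valuation nubar omegabar a gamma.

(** Automorphisms over [H] fix [a] and preserve [nubar], so they fix every implicit constant. A
    power of [z] separable over [H] then equals all its conjugates and lies in [H]; what remains is
    purely inseparable. *)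
Lemma implicit_constant_sub z H : is_subfield H -> range iota `<=` H -> H a ->
  henselian nubar H -> implicit_constant_field iota j W z -> H z.
Proof.
move=> sH iH Ha hH ICz; apply: contrapT => zN.
have ICX n : implicit_constant_field iota j W (z ^+ n).
  have sIC := subfield_henselization W (range (j \o frac_map iota)).
  rewrite /implicit_constant_field /mkset.
  have -> : j (frac_const (z ^+ n)) = j (frac_const z) ^+ n by rewrite !rmorphXn.
  exact (subfieldX n sIC ICz).
have [E [f fH]] := subfield_field sH.
have algf y : algebraicOver f y.
  by apply: algebraicOver_sub (Kbar_closure y); rewrite fH.
have Hsep n p : is_minpoly f (z ^+ n) p -> separable_poly p -> H (z ^+ n).
  move=> pv psep; apply: contrapT => vN; rewrite -fH in vN.
  have [v' rv' v'v] := separable_conjugate pv psep vN.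
  have [s [sf sv]] := conjugate_ex algf G pv rv'.
  have fix_H y : H y -> s y = y by rewrite -fH => -[c _ <-].
  have s_nubar y : nubar (s y) = nubar y.
    by apply: henselian_invariant sf y; rewrite fH.
  have /eqP : s (z ^+ n) = z ^+ n.
    apply: (@implicit_constant_fixed _ _ _ _ iota j Kbar_closure Omega_closure
      nubar omegabar W omegabar_nubar W_omegabar a gamma a_gamma s) (ICX n).
    - by move=> c; apply: fix_H; apply: iH; exists c.
    - exact: s_nubar.
    - by rewrite fix_H // subrr vfun0.
  by rewrite sv (negPf v'v).
have [[p pz psep]|[l lK [n [p [pz psep]]]]] := separable_power (algf z).
  by apply: zN; rewrite -[z]expr1; apply: (Hsep 1%N p).
pose Q m := `[< H (z ^+ (l ^ m)) >].
have exQ : exists m, Q m by exists n; apply/asboolP; exact: Hsep pz psep.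
case: (ex_minnP exQ) => -[|m] /asboolP Hm mmin; first by rewrite expn0 expr1 in Hm.
have {}mmin : ~ H (z ^+ (l ^ m)).
  by move=> Hm'; have := mmin m; rewrite ltnn => /(_ (asboolT Hm')).
have lO : l \in [pchar Omega] by rewrite (fmorph_pchar kappa).
(* The base is now enlarged from K(x) to H(x). There the last [l]-power of [z] outside [H] is an
   [l]-th root missing from H(x), hence from its henselization, although that contains K(x)^h. *)
have alg y : algebraicOver (j \o frac_map f) y.
  by apply: algebraicOver_sub (algKx y); apply: sub_frac_range; rewrite fH.
apply: (@henselian_avoiding _ _ (j \o frac_map f) alg G W l (kappa (z ^+ (l ^ m))) lO).
- by move=> /kappa_frac_range; rewrite fH.
- rewrite -rmorphXn -exprM -expnSr; move: Hm; rewrite -fH => -[c _ <-].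
  by exists (frac_const c); rewrite // /= frac_map_const.
- move=> H' [sH' fH' hH']; apply: (ICX (l ^ m)%N); split=> //.
  by apply: subset_trans fH'; apply: sub_frac_range; rewrite fH.
Qed.

End Upper.

Section Lower.
Variable H : set Omega.
Hypotheses (sH : is_subfield H) (KxH : Kx `<=` H) (hH : henselian W H).

Let H0 : set Kbar := [set z | H (kappa z)].

Lemma subfield_constants : is_subfield H0.
Proof.
have [H1 HB HV] := sH; split=> [|x y Hx Hy|x y Hx Hy].
- by change (H (kappa 1)); rewrite rmorph1.
- by change (H (kappa (x - y))); rewrite rmorphB; exact: HB.
- by change (H (kappa (x / y))); rewrite fmorph_div; exact: HV.
Qed.

Lemma base_constants : range iota `<=` H0.
Proof. by move=> _ [c _ <-]; apply: KxH; exact: kappa_base. Qed.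

(** The minimal polynomial of a constant over [H] divides [f], so its roots are again constants and
    its coefficients lie in [H0]. Conjugation over [H] inside [Omega] thereby becomes a statement
    about Kbar, and it is isometric because [H] is henselian. *)
Lemma constant_minpoly c (f : {poly K}) : f != 0 -> root (map_poly iota f) c ->
  exists rs : seq Kbar,
    [/\ c \in rs, \prod_(r <- rs) ('X - r%:P) %| map_poly iota f,
        forall k, H0 (\prod_(r <- rs) ('X - r%:P))`_k
      & forall r, r \in rs -> exists t : {rmorphism Omega -> Omega},
          [/\ forall y, H y -> t y = y, forall y, W (t y) = W y
            & t (kappa c) = kappa r] ].
Proof.
move=> f0 rf; have [E [i iH]] := subfield_field sH.
have algi y : algebraicOver i y.
  by apply: algebraicOver_sub (algKx y); rewrite iH.
have [p pc] := minpoly_ex (algi (kappa c)); have [pM _ rp] := pc.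
have [g gE] : exists g, map_poly i g = map_poly kappa (map_poly iota f).
  apply: poly_lift => k; rewrite iH !coef_map; apply: KxH; exact: kappa_base.
have pg : p %| g by rewrite -(minpoly_rootE _ pc) gE fmorph_root.
have [rs' rsE'] : exists rs, map_poly i p = \prod_(r <- rs) ('X - r%:P).
  by apply: closed_monic_split; rewrite map_monic.
have [rsf rsfE] := closed_field_poly_normal (map_poly iota f).
have l0 : lead_coef (map_poly iota f) != 0 by rewrite lead_coef_eq0 map_poly_eq0.
have rs'K r : r \in rs' -> exists r', kappa r' = r.
  rewrite -root_prod_XsubC -rsE' => rr.
  have : root (map_poly i g) r by have /dvdpP[q ->] := pg; rewrite rmorphM rootM rr orbT.
  rewrite gE rsfE linearZ /= rmorph_prod rootZ ?fmorph_eq0 //.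
  rewrite (eq_bigr (fun r' => 'X - (kappa r')%:P)); last first.
    by move=> r' _; rewrite rmorphB /= map_polyX map_polyC.
  rewrite -(big_map kappa xpredT (fun y => 'X - y%:P)) root_prod_XsubC.
  by case/mapP => r' _ ->; exists r'.
have [rs rs'rs] : exists rs, rs' = map kappa rs.
  elim: (rs') rs'K => [|r t IHt] tK; first by exists [::].
  have [r' rE] := tK r (mem_head _ _).
  have [|t' tE] := IHt; first by move=> y yt; apply: tK; rewrite inE yt orbT.
  by exists (r' :: t'); rewrite map_cons rE tE.
have pE : map_poly i p = map_poly kappa (\prod_(r <- rs) ('X - r%:P)).
  rewrite rsE' rs'rs big_map rmorph_prod; apply: eq_bigr => r _.
  by rewrite rmorphB /= map_polyX map_polyC.
exists rs; split.
- have : root (map_poly kappa (\prod_(r <- rs) ('X - r%:P))) (kappa c) by rewrite -pE.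
  by rewrite fmorph_root root_prod_XsubC.
- have : map_poly kappa (\prod_(r <- rs) ('X - r%:P)) %|
      map_poly kappa (map_poly iota f) by rewrite -pE -gE dvdp_map.
  by rewrite dvdp_map.
- move=> k; change (H (kappa (\prod_(r <- rs) ('X - r%:P))`_k)).
  by rewrite -coef_map -pE -iH coef_map; exists (p`_k).
- move=> r rrs; have rr : root (map_poly i p) (kappa r).
    by rewrite pE fmorph_root root_prod_XsubC.
  have [t [ti tc]] := conjugate_ex algi G pc rr.
  exists t; split=> // [y|]; first by rewrite -iH => -[d _ <-].
  by apply: henselian_invariant ti; rewrite iH.
Qed.

(** The [H]-conjugates of a constant all have its value, and the coefficients of their polynomial
    lie in [H0], so [one_slope] forces any competing valuation. *)
Lemma henselian_constants : henselian nubar H0.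
Proof.
move=> nu' nu'E c; have [->|c0] := eqVneq c 0; first by rewrite !vfun0.
have [f f0 rf] := Kbar_closure c.
have [rs [crs _ rsH conj]] := constant_minpoly f0 rf.
have [g cg] := vfun_neq0 nubar c0; rewrite cg.
apply: (@one_slope _ _ nubar nu' g rs) crs; last by move=> k; exact: nu'E.
move=> r /conj[t [_ tW tc]].
by rewrite -cg -!kappaW -tc tW.
Qed.

Lemma krasner_constants a gamma : is_monomial_valuation nubar omegabar a gamma ->
  separable_over iota a -> ~ range iota a -> kras iota nubar a < gamma -> H0 a.
Proof.
move=> a_gamma asep aN krg; have [_ krmax] := krasP nubar Kbar_closure asep aN.
have [p pa psep] := asep; have [pM _ rp] := pa.
have [rs [ars rsp rsH conj]] := constant_minpoly (monic_neq0 pM) rp.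
have rsu : uniq rs.
  by rewrite -separable_prod_XsubC (dvdp_separable rsp) // separable_map.
have [/hasP[r rrs ra]|/hasPn all_a] := boolP (has (fun r => r != a) rs).
  have rr : root (map_poly iota p) r.
    by have /dvdpP[q ->] := rsp; rewrite rootM root_prod_XsubC rrs orbT.
  have [s sG sa] := galois_conjugate G Kbar_closure pa rr.
  have idG : in_galois iota idfun by split=> //; exists idfun.
  have := krmax idfun s idG sG; rewrite sa /= => /(_ (nesym (elimN eqP ra))) kr.
  have [t [tH tW ta]] := conj r rrs.
  (* An automorphism over [H] fixes [x], so [x] is as close to the conjugate [r] as to [a]; then [a]
     and [r] are closer to each other than [kras] allows. *)
  pose x := j (FracField.tofrac 'X).
  have xH : H x.
    by apply: KxH; exists (FracField.tofrac 'X) => //=; rewrite frac_map_tofrac map_polyX.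
  have Wxa : lev (Some gamma) (W (x - kappa a)).
    rewrite /x /= -rmorphB W_omegabar -tofracB.
    exact: monomial_XsubC a_gamma.
  have Wxr : lev (Some gamma) (W (x - kappa r)).
    by rewrite -ta -(tH x xH) -rmorphB tW.
  have : lev (Some gamma) (nubar (a - r)).
    rewrite -kappaW rmorphB -[kappa a](subrK x) -addrA.
    by rewrite lev_vfunD // vfunBC.
  by move=> /lev_trans /(_ kr) /=; rewrite oag_leNgt krg.
have rs1 : rs = [:: a].
  move: rsu all_a ars; case: (rs) => [//|r [|r' t]] /=.
    by move=> _ _; rewrite inE => /eqP ->.
  move=> /andP[rN _] all_u _; move: rN.
  have /eqP -> : r == a by have := all_u r; rewrite inE eqxx negbK; exact.
  have /eqP -> : r' == a by have := all_u r'; rewrite !inE eqxx orbT negbK; exact.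
  by rewrite inE eqxx.
have := rsH 0%N; rewrite rs1 big_seq1 coefB coefX coefC sub0r.
by move=> /(subfieldN subfield_constants); rewrite opprK.
Qed.

End Lower.

End ImplicitConstantField.

(** * Degrees of simple extensions *)

Section Degrees.
Variables (K : fieldType) (L : closedFieldType) (i : {rmorphism K -> L}).

Lemma has_degree_minpoly u p : is_minpoly i u p ->
  has_degree (adjoin (range i) u) (range i) (size p).-1.
Proof.
move=> pu; have [pM [p1 _] rp] := pu.
have sp : size p = (size p).-1.+1 by rewrite prednK // ltnW.
exists (fun k => u ^+ k); split=> [k|z].
  by apply: (subfieldX _ (subfield_adjoin _ _)); exact: mem_adjoin.
rewrite (adjoin_algebraicE pu) => -[q _ <-].
pose r := q %% p.
have sr : (size r <= (size p).-1)%N by rewrite -ltnS -sp ltn_modp monic_neq0.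
have ru : (map_poly i q).[u] = (map_poly i r).[u].
  rewrite [in LHS](divp_eq q p) rmorphD rmorphM /= !hornerE.
  by rewrite (rootP rp) mulr0 add0r.
exists [ffun k : 'I_(size p).-1 => i r`_k]; split.
  split=> [k|]; first by rewrite ffunE; exists r`_k.
  rewrite ru (@horner_coef_wide _ (size p).-1) ?size_map_poly //.
  by apply: eq_bigr => k _; rewrite ffunE coef_map.
move=> c [ci cE].
have /choice[d dE] : forall k, exists x, i x = c k.
  by move=> k; have [x _ <-] := ci k; exists x.
pose D := \poly_(k < (size p).-1) (if insub k is Some k' then d k' else 0).
have Dk (k : 'I_(size p).-1) : D`_k = d k.
  by rewrite coef_poly ltn_ord valK.
have : root (map_poly i (D - r)) u.
  rewrite rootE rmorphB !hornerE subr_eq0 -ru cE; apply/eqP.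
  rewrite (@horner_coef_wide _ (size p).-1) ?size_map_poly ?size_poly //.
  by apply: eq_bigr => k _; rewrite coef_map /= Dk dE.
rewrite (minpoly_rootE _ pu) => pDr.
have /eqP : D - r = 0.
  apply/eqP/negPn/negP => Dr0; have := dvdp_leq Dr0 pDr.
  apply/negP; rewrite -ltnNge sp ltnS (leq_trans (size_polyD _ _)) //.
  by rewrite geq_max size_polyN sr size_poly.
rewrite subr_eq0 => /eqP Dr.
by apply/ffunP => k; rewrite ffunE -Dr Dk dE.
Qed.

(** With [n < m], the matrix of the second family in terms of the first has a nonzero row kernel,
    that is, a second expression of 0 in the second basis. *)
Lemma has_degree_le E n m : is_subfield E ->
  has_degree E (range i) n -> has_degree E (range i) m -> (m <= n)%N.
Proof.
move=> sE [e [eE eB]] [e' [eE' eB']]; rewrite leqNgt; apply/negP => nm.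
have /choice[A0 AE] : forall k : 'I_m, exists A : 'I_n -> K,
    e' k = \sum_(l < n) i (A l) * e l.
  move=> k; have [c [[ci cE] _]] := eB _ (eE' k).
  have /choice[A AE] : forall l, exists x, i x = c l.
    by move=> l; have [x _ <-] := ci l; exists x.
  by exists A; rewrite cE; apply: eq_bigr => l _; rewrite AE.
pose A := \matrix_(k < m, l < n) A0 k l.
have : kermx A != 0.
  rewrite -mxrank_eq0 mxrank_ker -lt0n subn_gt0.
  exact: leq_ltn_trans (rank_leq_col _) nm.
case/rowV0Pn => v /sub_kermxP vA v0.
have ve : \sum_(k < m) i (v 0 k) * e' k = 0.
  transitivity (\sum_(l < n) i ((v *m A) 0 l) * e l).
    under eq_bigr => k _ do rewrite AE mulr_sumr.
    rewrite exchange_big; apply: eq_bigr => l _; rewrite mxE rmorph_sum mulr_suml.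
    by apply: eq_bigr => k _; rewrite mxE rmorphM mulrA.
  by rewrite vA big1 // => l _; rewrite mxE rmorph0 mul0r.
have [c [_ cU]] := eB' 0 (subfield0 sE).
have c0 : c = [ffun=> 0].
  apply: cU; split=> [k|]; first by rewrite ffunE; exists 0; rewrite ?rmorph0.
  by rewrite big1 // => k _; rewrite ffunE mul0r.
have cv : c = [ffun k => i (v 0 k)].
  apply: cU; split=> [k|]; first by rewrite ffunE; exists (v 0 k).
  by rewrite -[LHS]ve; apply: eq_bigr => k _; rewrite ffunE.
move/eqP: v0; apply; apply/rowP => k; rewrite mxE.
have := congr1 (fun f : {ffun 'I_m -> L} => f k) cv.
by rewrite c0 !ffunE => /esym/eqP; rewrite fmorph_eq0 => /eqP.
Qed.

Lemma degree_minpoly u p : is_minpoly i u p ->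
  degree (adjoin (range i) u) (range i) = (size p).-1.
Proof.
move=> pu; have deg := has_degree_minpoly pu.
apply: xget_unique => // n degn; apply/eqP; rewrite eqn_leq.
have sA := subfield_adjoin (range i) u.
by rewrite (has_degree_le sA deg degn) (has_degree_le sA degn deg).
Qed.

End Degrees.

(** * Rank one: archimedean values and separation of conjugate valuations *)

Section RankOne.
Variables (R : realType) (G : orderedZmodType) (K : fieldType) (Kbar : closedFieldType).
Variables (iota : {rmorphism K -> Kbar}) (nu : valuation K G) (nubar : valuation Kbar G).
Hypothesis Kbar_closure : is_algebraic_closure iota.
Hypothesis nubar_nu : extends_valuation iota nu nubar.
Hypothesis nu_rank1 : rank_one R nu.

Let tor z : z != 0 -> exists m c g, [/\ (0 < m)%N, c != 0, nu c = Some (g *+ m) & nubar z = Some g].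
Proof.
move=> z0; have [g zg] := vfun_neq0 nubar z0.
have [m [c [m0 c0 zc]]] := algebraic_value_torsion nubar z0 (Kbar_closure z).
by exists m, c, g; split=> //; rewrite -nubar_nu -zc (vfunX _ zg).
Qed.

(** Only values of [nu] are mapped to the reals, so [g] and [h] are first replaced by the multiples
    [g *+ m] and [h *+ l] lying in the value group of [nu]; since [h] is positive, it is at most
    [h *+ l]. *)
Lemma rank_one_archimedean x y g h : nubar x = Some g -> nubar y = Some h ->
  0 < g -> exists n, h <= g *+ n.
Proof.
move=> xg yh g0; have [h0|h0] := boolP (h <= 0); first by exists 0%N.
rewrite -oag_ltNge in h0.
have [m [c [g' [m0 c0 cg]]]] := tor (vfun_fin_neq0 xg).
rewrite xg => -[E]; rewrite -{}E in cg.
have [l [d [h' [l0 d0 dh]]]] := tor (vfun_fin_neq0 yh).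
rewrite yh => -[E]; rewrite -{}E in dh.
have [_ [f fP]] := nu_rank1.
have vc n : value_group nu (g *+ m *+ n) by exists (c ^+ n); rewrite (vfunX _ cg).
have fD n : f (g *+ m *+ n.+1) = f (g *+ m) + f (g *+ m *+ n).
  by rewrite mulrS; apply: (fP _ _ (vc 1%N) (vc n)).1.
have f0 : f 0 = 0.
  have := fD 0%N; rewrite mulr1n mulr0n => /eqP.
  by rewrite -[X in X == _]addr0 (inj_eq (addrI _)) eq_sym => /eqP.
have fn n : f (g *+ m *+ n) = f (g *+ m) *+ n.
  by elim: n => [|n IHn]; rewrite ?mulr0n // fD IHn mulrS.
have gm0 : 0 < g *+ m by have := oag_ltrMn m0 g0; rewrite mul0rn.
have fgm : 0 < f (g *+ m) by rewrite -f0; apply: (fP _ _ (vc 0%N) (vc 1%N)).2.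
have hl0 : 0 < h *+ l by have := oag_ltrMn l0 h0; rewrite mul0rn.
have vd : value_group nu (h *+ l) by exists d.
have fhl : 0 < f (h *+ l) by rewrite -f0; apply: (fP _ _ (vc 0%N) vd).2.
pose n := Num.bound (f (h *+ l) / f (g *+ m)).
have fn_gt : f (h *+ l) < f (g *+ m *+ n).
  rewrite fn -mulr_natl -ltr_pdivrMr //; apply: archi_boundP.
  by rewrite divr_ge0 ?ltW.
have hn : h *+ l <= g *+ m *+ n.
  rewrite oag_leNgt; apply/negP => nh.
  by have := (fP _ _ (vc n) vd).2 nh; rewrite ltNge ltW.
exists (m * n)%N; apply: le_trans (oag_ler_mulrn l0 (ltW h0)) _.
by rewrite mulrnA.
Qed.

Lemma rank_one_eventually x y : ltv (Some 0) (nubar x) -> y != 0 ->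
  exists n, forall k, (n <= k)%N -> ltv (nubar y) (nubar (x ^+ k)).
Proof.
move=> x0 y0; have [h yh] := vfun_neq0 nubar y0.
have [xz|xN] := eqVneq x 0.
  by exists 1%N => -[//|k] _; rewrite xz expr0n vfun0 yh.
have [g xg] := vfun_neq0 nubar xN; rewrite xg /ltv /= -oag_ltNge in x0.
have [n hn] := rank_one_archimedean xg yh x0.
exists n.+1 => k nk; rewrite (vfunX _ xg) yh /ltv /= -oag_ltNge.
apply: le_lt_trans hn _; rewrite -(subnK nk) addnS mulrSr mulrnDr.
rewrite -[X in X < _]addr0 -[X in X + _ < _]add0r -!addrA.
apply: oag_ler_ltD; first exact/oag_mulrn_ge0/ltW.
exact: oag_ler_ltD.
Qed.

Lemma eventually_all (T : eqType) (s : seq T) (P : T -> nat -> Prop) :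
  (forall t, t \in s -> exists n, forall k, (n <= k)%N -> P t k) ->
  exists n, forall k, (n <= k)%N -> forall t, t \in s -> P t k.
Proof.
elim: s => [|t s IHs] H; first by exists 0%N.
have [n nP] := H t (mem_head _ _).
have [|m mP] := IHs; first by move=> u us; apply: H; rewrite inE us orbT.
exists (maxn n m) => k; rewrite geq_max => /andP[nk mk] u.
by rewrite inE => /predU1P[->|]; [exact: nP | exact: mP].
Qed.

Lemma rank_one_nontrivial : exists c, ltv (Some 0) (nu c) /\ c != 0.
Proof.
have [[g [c cg] g0] _] := nu_rank1; have cN := vfun_fin_neq0 cg.
have [gp|gn] := boolP (0 < g); first by exists c; rewrite cg /ltv /= -oag_ltNge.
exists c^-1; rewrite (vfunV cg) invr_neq0 // /ltv /= -oag_ltNge oag_oppr_gt0.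
by split=> //; rewrite lt_neqAle g0 oag_leNgt.
Qed.

(* For finitely many conjugates of nubar distinct from it on M, some element of
   M separates nubar from all of them by the sign of its value. *)
Section SeparateSigns.
Variables (M : set Kbar) (sg : Kbar -> {rmorphism Kbar -> Kbar}).
Hypotheses (sM : is_subfield M) (KM : range iota `<=` M).
Hypothesis sgK : forall b c, sg b (iota c) = iota c.

Let sgtor b z : z != 0 -> exists m c g,
  [/\ (0 < m)%N, c != 0, nu c = Some (g *+ m) & nubar (sg b z) = Some g].
Proof. by move=> z0; apply: tor; rewrite fmorph_eq0. Qed.

(** After replacing [y] by its inverse if necessary, the value [h] at the conjugate is below the
    value [g] at [nubar]. Dividing a power of [y] by a constant of [K] whose value is the midpoint
    makes one value positive and the other negative. *)
Lemma separate_sign1 b y : M y -> nubar (sg b y) <> nubar y ->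
  exists z, [/\ M z, z != 0, ltv (Some 0) (nubar z) & ltv (nubar (sg b z)) (Some 0)].
Proof.
move=> My yb; have y0 : y != 0 by apply: contra_notN yb => /eqP ->; rewrite rmorph0.
have sy0 : sg b y != 0 by rewrite fmorph_eq0.
wlog : y My yb y0 sy0 / ltv (nubar (sg b y)) (nubar y).
  move=> wl; have [g yg] := vfun_neq0 nubar y0; have [h yh] := vfun_neq0 nubar sy0.
  have [lt|] := boolP (ltv (nubar (sg b y)) (nubar y)); first exact: (wl y).
  move/negPn => le; apply: (wl y^-1).
  - exact: subfieldV.
  - rewrite fmorphV (vfunV yg) (vfunV yh) => -[/oppr_inj E].
    by apply: yb; rewrite yg yh E.
  - by rewrite invr_neq0.
  - by rewrite fmorph_eq0 invr_neq0.
  - rewrite fmorphV (vfunV yg) (vfunV yh); apply/negP => le'; apply: yb.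
    apply: lev_anti le; rewrite yg yh; move: le'; rewrite /= => le'.
    by have := oag_leD2l (g + h) _ _ le'; rewrite addrK addrAC subrr add0r.
have [m1 [c1 [g [m10 c10 c1g yg]]]] := tor y0.
have [m2 [c2 [h [m20 c20 c2h yh]]]] := sgtor b y0.
rewrite yg yh /ltv /= -oag_ltNge => hg.
pose N := (m1 * m2)%N; have N0 : (0 < N)%N by rewrite muln_gt0 m10.
(* The midpoint constant: [d] has value [(g + h) *+ N], so dividing [y ^+ (2 * N)] by it leaves
   [(g - h) *+ N] at [nubar] and [(h - g) *+ N] at the conjugate. *)
pose d := c1 ^+ m2 * c2 ^+ m1.
have dE : nubar (iota d) = Some ((g + h) *+ N).
  rewrite nubar_nu vfunM (vfunX _ c1g) (vfunX _ c2h) /addv -!mulrnA.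
  by rewrite [(m2 * m1)%N]mulnC mulrnDl.
have zE z k : nubar z = Some k ->
    nubar (z ^+ (2 * N) / iota d) = Some ((k + k - (g + h)) *+ N).
  move=> zk; rewrite vfunM (vfunX _ zk) (vfunV dE) /addv mulrnA mulr2n.
  by rewrite mulrnBl.
exists (y ^+ (2 * N) / iota d); split.
- by case: (sM) => _ _; apply; [exact: subfieldX | apply: KM; exists d].
- by rewrite mulf_neq0 ?expf_neq0 ?invr_neq0 ?fmorph_eq0 // mulf_neq0 ?expf_neq0.
- rewrite (zE _ _ yg) /ltv /= -oag_ltNge -[X in X < _](mul0rn _ N) oag_ltrMn //.
  by rewrite oag_lt_subr oag_ltD2lE.
- rewrite fmorph_div rmorphXn sgK (zE _ _ yh) /ltv /= -oag_ltNge.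
  rewrite -[X in _ < X](mul0rn _ N) oag_ltrMn // -oag_oppr_gt0 opprB oag_lt_subr.
  by rewrite [g + h]addrC oag_ltD2lE.
Qed.

(** Induction in the style of weak approximation: [t] serves the earlier conjugates and [f] serves
    the new one [b]. If [t] is not negative at [b], it is replaced by [t ^+ n * f] or
    [(1 + t ^+ n.+1) * f], according to whether its value there is zero or positive; [n] is so large
    that the negative values of [t] at the earlier conjugates outweigh those of [f]. *)
Lemma separate_signs (bs : seq Kbar) :
  (forall b, b \in bs -> exists2 y, M y & nubar (sg b y) <> nubar y) ->
  exists z, [/\ M z, z != 0, ltv (Some 0) (nubar z)
    & forall b, b \in bs -> ltv (nubar (sg b z)) (Some 0)].
Proof.
elim: bs => [|b bs IHbs] H.
  have [c [cv c0]] := rank_one_nontrivial.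
  by exists (iota c); split; rewrite ?fmorph_eq0 ?nubar_nu //; apply: KM; exists c.
have [|t [Mt t0 tv tbs]] := IHbs; first by move=> u us; apply: H; rewrite inE us orbT.
have [y My yb] := H b (mem_head _ _).
have [f [Mf f0 fv fb]] := separate_sign1 My yb.
have [tb|tb] := boolP (ltv (nubar (sg b t)) (Some 0)).
  by exists t; split=> // u; rewrite inE => /predU1P[->|/tbs].
have MX n : M (t ^+ n) by exact: subfieldX.
have ev : exists n, forall k, (n <= k)%N -> forall u, u \in bs ->
    ltv (nubar (sg u (t ^+ k * f))) (Some 0).
  apply: eventually_all => u ubs.
  have su0 : sg u t != 0 by rewrite fmorph_eq0.
  have sf0 : sg u f != 0 by rewrite fmorph_eq0.
  have [g tg] := vfun_neq0 nubar su0; have [h fh] := vfun_neq0 nubar sf0.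
  have := tbs u ubs; rewrite tg /ltv /= -oag_ltNge => g0.
  have [|//|n nP] := @rank_one_eventually (sg u t)^-1 (sg u f).
    by rewrite (vfunV tg) /ltv /= -oag_ltNge oag_oppr_gt0.
  exists n => k /nP; rewrite rmorphM rmorphXn vfunM (vfunX _ tg) (vfunX _ (vfunV tg)) fh.
  by rewrite /ltv /= -!oag_ltNge mulNrn -[h in h < _]addr0 -oag_lt_subr addr0 -opprD oag_oppr_gt0.
have [n nP] := ev.
have fbt k : nubar (sg b t) = Some 0 -> ltv (nubar (sg b (t ^+ k * f))) (Some 0).
  by move=> tb0; rewrite rmorphM rmorphXn vfunM (vfunX _ tb0) mul0rn add0v.
have [tb0|tbN] := eqVneq (nubar (sg b t)) (Some 0).
  exists (t ^+ n * f); split.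
  - exact: subfieldM.
  - by rewrite mulf_neq0 ?expf_neq0.
  - have [g tg] := vfun_neq0 nubar t0; rewrite vfunM (vfunX _ tg).
    rewrite tg /ltv /= -oag_ltNge in tv; have [h fh] := vfun_neq0 nubar f0.
    rewrite fh /ltv /= -oag_ltNge in fv.
    rewrite fh /addv /ltv /= -oag_ltNge -[X in X < _]addr0.
    by apply: oag_ler_ltD => //; exact/oag_mulrn_ge0/ltW.
  - by move=> u; rewrite inE => /predU1P[->|ubs]; [exact: fbt | exact: nP].
(* 1 + t^k has value 0 where t is positive, and k v(t) where t is negative. *)
have one_pos w k : ltv (Some 0) (nubar w) -> nubar (1 + w ^+ k.+1) = Some 0.
  move=> w0; rewrite vfunD_dom vfun1 //.
  have [->|wN] := eqVneq w 0; first by rewrite expr0n vfun0.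
  have [g wg] := vfun_neq0 nubar wN; rewrite (vfunX _ wg).
  rewrite wg /ltv /= -!oag_ltNge in w0 *.
  by have := oag_ltrMn (ltn0Sn k) w0; rewrite mul0rn.
have tbp : ltv (Some 0) (nubar (sg b t)).
  move: tb tbN; have [|g ->] := @vfun_neq0 _ _ nubar (sg b t); first by rewrite fmorph_eq0.
  rewrite /ltv /= negbK -oag_ltNge lt_neqAle => -> g0; rewrite andbT.
  by apply: contraNneq g0 => <-.
have ubs_lt u k : u \in bs -> nubar (1 + sg u t ^+ k.+1) = nubar (sg u t ^+ k.+1).
  move=> /tbs ut; rewrite addrC vfunD_dom // vfun1.
  have [|g ug] := @vfun_neq0 _ _ nubar (sg u t); first by rewrite fmorph_eq0.
  rewrite (vfunX _ ug); rewrite ug /ltv /= -!oag_ltNge in ut *.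
  by have := oag_ltrMn (ltn0Sn k) ut; rewrite mul0rn.
exists ((1 + t ^+ n.+1) * f); split.
- by apply: subfieldM => //; apply: subfieldD => //; case: (sM).
- rewrite mulf_neq0 //; apply/eqP => E.
  by have := one_pos t n tv; rewrite E vfun0.
- by rewrite vfunM one_pos // add0v.
- move=> u; rewrite inE rmorphM rmorphD rmorph1 rmorphXn vfunM => /predU1P[->|ubs].
    by rewrite one_pos // add0v.
  by rewrite ubs_lt // -vfunM -rmorphXn -rmorphM; apply: nP.
Qed.

End SeparateSigns.

End RankOne.

(** * Rank one: approximation and isometric conjugates *)

Lemma oag_npos_lerMn (G : orderedZmodType) (g : G) k n :
  g <= 0 -> (k <= n)%N -> g *+ n <= g *+ k.
Proof.
move=> g0 kn; rewrite -(subnK kn) mulrnDr -[X in _ <= X]add0r oag_leD2r //.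
by rewrite -(mul0rn G (n - k)); exact: oag_lerMn.
Qed.

Section ProductBounds.
Variables (L : closedFieldType) (G : orderedZmodType) (v : valuation L G).

Lemma lev_vprod_sub (g : G) (x : L) (rs : seq L) :
  (forall r, r \in rs -> lev (Some g) (v (x - r))) ->
  lev (Some (g *+ size rs)) (v (\prod_(r <- rs) (x - r))).
Proof.
elim: rs => [|r rs IHrs] H; first by rewrite big_nil vfun1 levv.
rewrite big_cons vfunM addv_mulrS lev_addv ?H ?mem_head ?IHrs // => t ts.
by apply: H; rewrite inE ts orbT.
Qed.

Lemma root_near (g : G) (x : L) (rs : seq L) : rs != [::] ->
  lev (Some (g *+ size rs)) (v (\prod_(r <- rs) (x - r))) ->
  exists2 r, r \in rs & lev (Some g) (v (x - r)).
Proof.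
move=> rs0 H; apply: contrapT => /forall2NP far.
have {}far r : r \in rs -> ltv (v (x - r)) (Some g).
  by move=> rrs; have [//|/negP] := far r.
suff : ltv (v (\prod_(r <- rs) (x - r))) (Some (g *+ size rs)) by rewrite /ltv H.
case: rs {H} rs0 far => // r rs _; elim: rs r => [|t rs IHrs] r far.
  by rewrite big_seq1 far ?mem_head.
rewrite big_cons vfunM addv_mulrS; apply: ltv_addv; rewrite ?far ?mem_head //.
  by apply/ltv_lev/IHrs => u us; apply: far; rewrite inE us orbT.
have [|h ->] := @ltv_fin G (v (\prod_(j <- (t :: rs)) (x - j))) (Some (g *+ size (t :: rs))); last by [].
by apply: IHrs => u us; apply: far; rewrite inE us orbT.
Qed.

Lemma lev_horner (g s : G) (x : L) (q : {poly L}) n : g <= 0 ->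
  lev (Some g) (v x) -> (size q <= n)%N -> lev (Some s) (gauss v q) ->
  lev (Some (s + g *+ n)) (v q.[x]).
Proof.
move=> g0 gx qn sq; rewrite (horner_coef_wide _ qn); apply: lev_vsum => k _.
rewrite vfunM -[Some (s + _)]/(addv (Some s) (Some (g *+ n))); apply: lev_addv.
  exact: lev_trans sq (gauss_le _ _ _).
apply: (@lev_trans _ _ (Some (g *+ k))).
  exact: oag_npos_lerMn (ltnW (ltn_ord k)).
elim: (nat_of_ord k) => [|l IHl]; first by rewrite vfun1 levv.
by rewrite exprS vfunM addv_mulrS lev_addv.
Qed.

(** The bound by 0 is imposed so that multiples of the minimum decrease: estimates with different
    numbers of factors can then be brought to a common one. *)
Lemma vfun_min_ex (rs : seq L) : all (fun r => r != 0) rs ->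
  exists z, [/\ z != 0, lev (v z) (Some 0) & forall r, r \in rs -> lev (v z) (v r)].
Proof.
elim: rs => [|r rs IHrs] /=; first by exists 1; rewrite oner_neq0 vfun1 levv.
case/andP => r0 /IHrs[z [z0 z1 zmin]].
have [rz|zr] := orP (lev_total (v r) (v z)).
  exists r; split=> [//||t]; first exact: lev_trans rz z1.
  by rewrite inE => /predU1P[->|/zmin zt]; [exact: levv | exact: lev_trans rz zt].
by exists z; split=> // t; rewrite inE => /predU1P[->|/zmin].
Qed.

End ProductBounds.

Section ConjugateRankOne.
Variables (R : realType) (G : orderedZmodType) (K : fieldType) (Kbar : closedFieldType).
Variables (iota : {rmorphism K -> Kbar}) (nu : valuation K G) (nubar : valuation Kbar G).
Hypothesis Kbar_closure : is_algebraic_closure iota.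
Hypothesis nubar_nu : extends_valuation iota nu nubar.
Hypothesis nu_rank1 : rank_one R nu.

(* If the conjugates of a defining the same valuation on K(a) as a were a proper
   subset B0 of all the conjugates, pick e in K(a) close to 1 at B0 and to 0 at
   the others.  The characteristic polynomial of a e over K is then close to
   T^l \prod_(r in B0) (T - r), and the polynomial over K obtained by dropping
   its l lowest coefficients has a root near a and a smaller degree than a. *)
Lemma rank_one_conjugate (a : Kbar) (gamma : G) (p : {poly K}) (r : Kbar) :
  (exists2 h, value_group nu h & gamma <= h) ->
  (forall b, lev (Some gamma) (nubar (a - b)) ->
    (degree (adjoin (range iota) a) (range iota)
       <= degree (adjoin (range iota) b) (range iota))%N) ->
  is_minpoly iota a p -> separable_poly p -> ~ range iota a ->
  root (map_poly iota p) r ->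
  exists s : {rmorphism Kbar -> Kbar},
    [/\ forall c, s (iota c) = iota c, s a = r & forall z, nubar (s z) = nubar z].
Proof.
move=> gamma_bound amin pa psep aN rr; have [pM [p1 _] ra] := pa.
pose M := adjoin (range iota) a.
have sM : is_subfield M := subfield_adjoin _ _.
have KM : range iota `<=` M by exact: sub_adjoin.
have Ma : M a by exact: mem_adjoin.
have [rs rsE] : exists rs, map_poly iota p = \prod_(r <- rs) ('X - r%:P).
  by apply: closed_monic_split; rewrite map_monic.
have rrs b : root (map_poly iota p) b = (b \in rs) by rewrite rsE root_prod_XsubC.
have srs : size p = (size rs).+1 by rewrite -(size_map_poly iota) rsE size_prod_XsubC.
have /choice[sg sgP] : forall b, exists s : {rmorphism Kbar -> Kbar},
    (forall c, s (iota c) = iota c) /\ (b \in rs -> s a = b).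
  move=> b; have [brs|_] := boolP (b \in rs); last by exists idfun.
  have rb : root (map_poly iota p) b by rewrite rrs.
  by have [s [si sa]] := conjugate_ex Kbar_closure G pa rb; exists s.
have sgK b c : sg b (iota c) = iota c by have [] := sgP b.
have sga b : b \in rs -> sg b a = b by have [] := sgP b.
have sg_horner b q : b \in rs -> sg b (map_poly iota q).[a] = (map_poly iota q).[b].
  by move=> brs; rewrite -horner_map (map_fixed_poly (sgK b)) /= sga.
pose iso b := `[< forall y, M y -> nubar (sg b y) = nubar y >].
have [iso_r|niso_r] := boolP (iso r).
  apply: (isometric_extension_root Kbar_closure pa) => q.
  have -> : (map_poly iota q).[r] = sg r (map_poly iota q).[a] by rewrite sg_horner -?rrs.
  by rewrite (asboolW iso_r) // /M (adjoin_algebraicE pa); exists q.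
exfalso.
pose B0 := filter iso rs; pose B1 := filter (fun b => ~~ iso b) rs.
have B1P b : b \in B1 -> exists2 y, M y & nubar (sg b y) <> nubar y.
  rewrite mem_filter => /andP[/asboolPn/existsNP[y /not_implyP[My yb]] _].
  by exists y.
have [t [Mt t0 tv tB1]] := separate_signs Kbar_closure nubar_nu nu_rank1 sM KM sgK B1P.
have sga_id y : M y -> sg a y = y.
  rewrite /M (adjoin_algebraicE pa) => -[q _ <-].
  by rewrite sg_horner // -rrs.
have iso_a : iso a by apply/asboolP => y My; rewrite sga_id.
have aB0 : a \in B0 by rewrite mem_filter iso_a -rrs.
have rB1 : r \in B1 by rewrite mem_filter niso_r -rrs.
have rs0 : all (fun b => b != 0) rs.
  apply/allP => b brs; apply/eqP => b0; case: aN.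
  have : sg b a = 0 by rewrite sga.
  by move/eqP; rewrite fmorph_eq0 => /eqP ->; exists 0; rewrite ?rmorph0.
have [z0 [z0N z0le z0min]] := vfun_min_ex nubar rs0.
have [g z0g] := vfun_neq0 nubar z0N.
have g0 : g <= 0 by move: z0le; rewrite z0g.
have gmin b : b \in rs -> lev (Some g) (nubar b) by rewrite -z0g; exact: z0min.
have [h [d dh] gh] := gamma_bound.
have dh' : nubar (iota d) = Some h by rewrite nubar_nu.
have dN : iota d != 0 by rewrite fmorph_eq0; exact: vfun_fin_neq0 dh.
have aNz : a != 0 by move/allP: rs0; apply; rewrite -rrs.
have [ag aE] := vfun_neq0 nubar aNz.
pose m := size B0; pose l := size B1; pose n := size rs.
have perm : perm_eq (B0 ++ B1) rs by rewrite perm_filterC.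
have nE : n = (m + l)%N by rewrite /n -(perm_size perm) size_cat.
have m0 : (0 < m)%N by rewrite /m; case: (B0) aB0.
have l0 : (0 < l)%N by rewrite /l; case: (B1) rB1.
(* With [v] for [nubar], the value [beta] of [y0] is [m h + l v(a) - (n + 1) g]. It turns the common
   lower bound [(n + 1) g + delta] of the estimates below into [m h + l v(a)], where [m h] brings a
   root near [a] and [l v(a)] pays for the factor [a ^+ l]. *)
pose y0 := iota d ^+ m * a ^+ l / z0 ^+ n.+1.
have y0N : y0 != 0 by rewrite !mulf_neq0 ?invr_neq0 ?expf_neq0.
have z0VN : z0^-1 != 0 by rewrite invr_neq0.
have [k [kb1 kb2 kb3]] : exists k, [/\ (0 < k)%N,
    forall x, x \in t :: [seq (sg b t)^-1 | b <- B1] -> ltv (nubar y0) (nubar (x ^+ k))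
  & forall x, x \in t :: [seq (sg b t)^-1 | b <- B1] -> ltv (nubar z0^-1) (nubar (x ^+ k))].
  have pos x : x \in t :: [seq (sg b t)^-1 | b <- B1] -> ltv (Some 0) (nubar x).
    rewrite inE => /predU1P[-> //|/mapP[b bB1 ->]].
    have sbt : sg b t != 0 by rewrite fmorph_eq0.
    have [u ut] := vfun_neq0 nubar sbt; have := tB1 b bB1.
    by rewrite (vfunV ut) ut /ltv /= -!oag_ltNge oag_oppr_gt0.
  have ev y : y != 0 -> exists n, forall k, (n <= k)%N ->
      forall x, x \in t :: [seq (sg b t)^-1 | b <- B1] -> ltv (nubar y) (nubar (x ^+ k)).
    move=> yN; apply: eventually_all => x xs.
    exact: (rank_one_eventually Kbar_closure nubar_nu nu_rank1 (pos x xs) yN).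
  have [n1 n1P] := ev y0 y0N; have [n2 n2P] := ev _ z0VN.
  exists (maxn n1 n2).+1; split=> //; [apply: n1P|apply: n2P].
    by rewrite leqW // leq_maxl.
  by rewrite leqW // leq_maxr.
have [beta y0b] := vfun_neq0 nubar y0N.
pose e := (1 + t ^+ k)^-1.
have tk_pos x : ltv (Some 0) (nubar x) -> nubar (1 + x ^+ k) = Some 0.
  move=> x0; rewrite vfunD_dom vfun1 //.
  have [->|xN] := eqVneq x 0; first by rewrite expr0n eqn0Ngt kb1 vfun0.
  have [u xu] := vfun_neq0 nubar xN; rewrite (vfunX _ xu).
  rewrite xu /ltv /= -!oag_ltNge in x0 *.
  by have := oag_ltrMn kb1 x0; rewrite mul0rn.
have M1 : M 1 by have [] := sM.
have Me : M e := subfieldV sM (subfieldD sM M1 (subfieldX k sM Mt)).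
have eE b : sg b e = (1 + sg b t ^+ k)^-1 by rewrite fmorphV rmorphD rmorph1 rmorphXn.
have e_B0 b : b \in B0 -> nubar (sg b e) = Some 0.
  rewrite mem_filter => /andP[/asboolP isob _]; rewrite isob //.
  by rewrite (vfunV (tk_pos _ tv)) oppr0.
have e_B1 b : b \in B1 -> nubar (sg b e) = nubar ((sg b t)^-1 ^+ k).
  move=> bB1; have sbt : sg b t != 0 by rewrite fmorph_eq0.
  have [u ut] := vfun_neq0 nubar sbt.
  have u0 : u < 0 by have := tB1 b bB1; rewrite ut /ltv /= -oag_ltNge.
  have E : nubar (1 + sg b t ^+ k) = Some (u *+ k).
    rewrite addrC vfunD_dom (vfunX _ ut) // vfun1 /ltv /= -oag_ltNge.
    by have := oag_ltrMn kb1 u0; rewrite mul0rn.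
  by rewrite eE (vfunV E) (vfunX _ (vfunV ut)) mulNrn.
have inB1 b : b \in B1 -> (sg b t)^-1 \in t :: [seq (sg b t)^-1 | b <- B1].
  by move=> bB1; rewrite inE; apply/orP; right; apply/mapP; exists b.
have b01 b : b \in rs -> b \in B0 \/ b \in B1.
  by rewrite -(perm_mem perm) mem_cat => /orP.
(* Besides reaching [beta], the precision must outweigh [g]: once [g + delta] is nonnegative, all
   coefficients of [V] below degree [l] have value at least [g + delta]. The two candidates [- g]
   and [beta] explain the two conditions on [k]. *)
have [delta [bd gd dP]] : exists delta, [/\ beta <= delta, 0 <= g + delta &
    forall x, x \in t :: [seq (sg b t)^-1 | b <- B1] -> lev (Some delta) (nubar (x ^+ k))].
  have [bg|gb] := orP (oag_le_total beta (- g)).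
    exists (- g); split=> // [|x xs]; first by rewrite subrr.
    by rewrite -(vfunV z0g); exact/ltv_lev/kb3.
  exists beta; split=> // [|x xs]; last by rewrite -y0b; exact/ltv_lev/kb2.
  by have := oag_leD2l g _ _ gb; rewrite subrr.
have delta0 : 0 <= delta.
  by apply: le_trans gd _; have := oag_leD2r delta g0; rewrite add0r.
pose y b := b * sg b e.
have yB1 b : b \in B1 -> lev (Some (g + delta)) (nubar (y b)).
  move=> bB1; rewrite vfunM e_B1 // -[Some _]/(addv (Some g) (Some delta)).
  by apply: lev_addv; [apply: gmin; move: bB1; rewrite mem_filter => /andP[] | exact/dP/inB1].
have yg b : b \in rs -> lev (Some g) (nubar (y b)).
  move=> brs; have [bB0|/yB1] := b01 b brs.
    by rewrite vfunM e_B0 // addv0 gmin.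
  by apply: lev_trans; exact: oag_ler_addr.
have [Pe _ PeE] : [set (map_poly iota q).[a] | q in setT] e.
  by rewrite -(adjoin_algebraicE pa).
have [C CE] := norm_poly1_ex ('X * Pe) pM p1.
have FE : map_poly iota C = \prod_(b <- rs) ('X - (y b)%:P).
  rewrite (CE _ _ _ rsE) !big_seq; apply: eq_bigr => b brs.
  by rewrite rmorphM /= map_polyX !hornerE -sg_horner // PeE.
pose F := map_poly iota C; rewrite -/F in FE.
pose U := \prod_(b <- B0) ('X - (y b)%:P); pose V := \prod_(b <- B1) ('X - (y b)%:P).
have FUV : F = U * V by rewrite FE -(perm_big _ perm) big_cat.
have UE : U = \prod_(x <- map y B0) ('X - x%:P) by rewrite big_map.
have VE : V = \prod_(x <- map y B1) ('X - x%:P) by rewrite big_map.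
have FE' : F = \prod_(x <- map y rs) ('X - x%:P) by rewrite big_map.
have gU : lev (Some (g *+ m)) (gauss nubar U).
  apply/lev_gaussP => c; rewrite UE.
  have /lev_trans : lev (Some (g *+ m)) (Some (g *+ (size (map y B0) - c))).
    by rewrite size_map; exact: oag_npos_lerMn (leq_subr _ _).
  apply; apply: lev_prod_XsubC => _ /mapP[b + ->].
  by rewrite mem_filter => /andP[_]; exact: yg.
have gV : lev (Some (g + delta)) (gauss nubar (V - 'X^l)).
  have sV : size V = l.+1 by rewrite VE size_prod_XsubC size_map.
  apply/lev_gaussP => c; rewrite coefB coefXn; have [lc|lc|->] := ltngtP c l.
  - rewrite subr0 VE.
    have /lev_trans : lev (Some (g + delta)) (Some ((g + delta) *+ (size (map y B1) - c))).
      by rewrite size_map; apply: oag_ler_mulrn => //; rewrite subn_gt0.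
    by apply; apply: lev_prod_XsubC => _ /mapP[b /yB1 + ->].
  - by rewrite subr0 nth_default ?sV // vfun0.
  - have /monicP : V \is monic by rewrite monic_prod_XsubC.
    by rewrite lead_coefE sV /= => ->; rewrite subrr vfun0.
have gtake : lev (Some (g + delta + g *+ m)) (gauss nubar (take_poly l F)).
  apply/lev_gaussP => c; rewrite coef_take_poly; case: ltnP => cl; last by rewrite vfun0.
  (* Below degree [l] the product of ['X^l] and [U] contributes nothing, so only the small part of
     [V] is seen. *)
  have -> : F`_c = ((V - 'X^l) * U)`_c.
    by rewrite mulrBl coefB coefXnM cl subr0 mulrC -FUV.
  apply: lev_trans (gauss_le _ _ _); rewrite gaussM.
  by rewrite -[Some (_ + _ *+ m)]/(addv (Some (g + delta)) (Some (g *+ m))) lev_addv.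
have ga : lev (Some g) (nubar a) by apply: gmin; rewrite -rrs.
have valT : lev (Some (g + delta + g *+ m + g *+ l)) (nubar (take_poly l F).[a]).
  exact: lev_horner g0 ga (size_take_poly _ _) gtake.
(* The factor of [F] at [a] itself is [a * (1 - e)], which is small; the other [n - 1] factors have
   value at least [g], and [g <= 0] permits the weaker bound with [n]. *)
have valF : lev (Some (g + delta + g *+ m + g *+ l)) (nubar F.[a]).
  have ars : a \in rs by rewrite -rrs.
  rewrite FE horner_prod (big_rem a) // vfunM.
  rewrite -addrA -mulrnDr -nE -[Some (_ + g *+ n)]/(addv (Some (g + delta)) (Some (g *+ n))).
  apply: lev_addv.
    rewrite !hornerE /y sga_id // -[X in X - _]mulr1 -mulrBr vfunM.
    rewrite -[Some (g + delta)]/(addv (Some g) (Some delta)) lev_addv //.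
    have -> : 1 - e = t ^+ k * e.
      have N0 : 1 + t ^+ k != 0.
        by apply/eqP => E; have := tk_pos t tv; rewrite E vfun0.
      by rewrite -[1](mulfV N0) -/e mulrDl mul1r addrAC subrr add0r.
    rewrite vfunM -[e](sga_id e Me) (e_B0 a aB0) addv0; apply: dP; exact: mem_head.
  apply: (@lev_trans _ _ (Some (g *+ size (rem a rs)))).
    by apply: oag_npos_lerMn => //; rewrite size_rem // leq_pred.
  rewrite (eq_bigr (fun b => a - y b)); last by move=> b _; rewrite !hornerE.
  rewrite -(big_map y xpredT (fun x => a - x)) -(size_map y).
  apply: lev_vprod_sub => _ /mapP[b /mem_rem brs ->].
  by apply: lev_vfunB => //; exact: yg.
(* [F] minus its low part is ['X^l] times this polynomial, so its value at [a] is controlled by the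
   two preceding estimates. Its degree is [m], smaller than the degree [n] of [a]. *)
pose q := drop_poly l C.
have qE : map_poly iota q = drop_poly l F.
  by apply/polyP => c; rewrite coef_map !coef_drop_poly coef_map.
have CM : C \is monic by rewrite -(map_monic iota) -/F FE monic_prod_XsubC.
have sC : size C = n.+1 by rewrite -(size_map_poly iota) -/F FE' size_prod_XsubC size_map.
have sq : size q = m.+1 by rewrite size_drop_poly sC nE -addSn addnK.
have qM : q \is monic.
  by rewrite monicE lead_coefE sq coef_drop_poly -nE -[n]/(n.+1.-1) -sC -lead_coefE (monicP CM).
have [bs bsE] : exists rs, map_poly iota q = \prod_(r <- rs) ('X - r%:P).
  by apply: closed_monic_split; rewrite map_monic.
have sbs : size bs = m.
  by apply/eqP; rewrite -eqSS -(size_prod_XsubC bs id) -bsE size_map_poly sq.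
(* The value at [a] of the product over the [m] roots is at least [m h], hence at least [m gamma],
   so one of the factors has value at least [gamma]. *)
have [b bbs ab] : exists2 b, b \in bs & lev (Some gamma) (nubar (a - b)).
  apply: root_near; first by rewrite -size_eq0 sbs -lt0n.
  have -> : \prod_(b <- bs) (a - b) = (drop_poly l F).[a].
    by rewrite -qE bsE horner_prod; apply: eq_bigr => b _; rewrite !hornerE.
  have : lev (Some (g + delta + g *+ m + g *+ l)) (nubar ((drop_poly l F).[a] * a ^+ l)).
    have -> : (drop_poly l F).[a] * a ^+ l = F.[a] - (take_poly l F).[a].
      rewrite -[X in X.[a] - _](poly_take_drop l F) hornerD hornerM hornerXn.
      by rewrite addrAC subrr add0r.
    exact: lev_vfunB.
  rewrite vfunM (vfunX _ aE) sbs; case: (nubar _) => [w|] //= wP.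
  apply: (le_trans (oag_lerMn m gh)); have := le_trans _ wP.
  move=> /(_ (h *+ m + ag *+ l)); rewrite ![_ + ag *+ l]addrC oag_leD2lE; apply.
  rewrite -addrA -mulrnDr -nE [g + delta]addrC -addrA -mulrS.
  apply: le_trans (oag_leD2r _ bd); move: y0b.
  rewrite vfunM (vfunV (vfunX _ z0g)) vfunM (vfunX _ aE) (vfunX _ dh').
  by rewrite /addv => -[<-]; rewrite subrK addrC.
have rb : root (map_poly iota q) b by rewrite bsE root_prod_XsubC.
have [pb pbb] : exists pb, is_minpoly iota b pb.
  by apply: minpoly_ex; exists q => //; exact: monic_neq0.
have := amin b ab; rewrite (degree_minpoly pa) (degree_minpoly pbb) srs /=.
apply/negP; rewrite -ltnNge.
have : (size pb <= size q)%N by rewrite dvdp_leq ?monic_neq0 // -(minpoly_rootE _ pbb).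
rewrite sq => pbm; rewrite -/n nE -addn1.
apply: leq_trans (_ : m + 1 <= _)%N; last by rewrite leq_add2l.
by rewrite addn1 addn1 ltnS; case: (size pb) pbm.
Qed.

End ConjugateRankOne.

(** * The equivalence *)

(** Used to pass from [gamma], a value of Kbar(x), to a value of K(x), where cofinality applies. A
    positive value is at most any positive multiple of itself, and some such multiple is a value of
    the base. *)
Lemma value_bounded_by_base (F : fieldType) (L : closedFieldType)
    (G : orderedZmodType) (i : {rmorphism F -> L}) (v : valuation L G) z g :
  algebraicOver i z -> v z = Some g ->
  exists c h, [/\ v (i c) = Some h, c != 0 & g <= h].
Proof.
move=> algz zg; have [g0|g0] := boolP (g <= 0).
  by exists 1, 0; rewrite rmorph1 vfun1 oner_neq0.
have [m [c [m0 c0 zc]]] := algebraic_value_torsion v (vfun_fin_neq0 zg) algz.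
exists c, (g *+ m); rewrite -zc (vfunX _ zg); split=> //.
by apply: oag_ler_mulrn => //; rewrite ltW // oag_ltNge.
Qed.

Theorem corollary6p4 (R : realType) (G : orderedZmodType)
    (K : fieldType) (Kbar Omega : closedFieldType)
    (iota : {rmorphism K -> Kbar})
    (j : {rmorphism {fraction {poly Kbar}} -> Omega})
    (Kbar_closure : is_algebraic_closure iota)
    (Omega_closure : is_algebraic_closure j)
    (nu : valuation K G) (omega : valuation {fraction {poly K}} G)
    (nubar : valuation Kbar G) (omegabar : valuation {fraction {poly Kbar}} G)
    (W : valuation Omega G)
    (omega_nu : extends_valuation (@frac_const K) nu omega)
    (nubar_nu : extends_valuation iota nu nubar)
    (omegabar_omega : extends_valuation (frac_map iota) omega omegabar)
    (omegabar_nubar : extends_valuation (@frac_const Kbar) nubar omegabar)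
    (W_omegabar : extends_valuation j omegabar W)
    (hensel_or_rank_one : henselian nubar (range iota) \/ rank_one R nu)
    (omega_vt : valuation_transcendental nu omega)
    (nu_cofinal : cofinal_values nu omega)
    (a : Kbar) (gamma : G)
    (a_gamma : minimal_pair_of_definition iota nubar omegabar a gamma)
    (a_separable : separable_over iota a)
    (a_notin_K : ~ range iota a) :
  implicit_constant_field iota j W =
    henselization nubar (adjoin (range iota) a)
  <-> kras iota nubar a < gamma.
Proof.
have [[gamma_val a_mon] a_min] := a_gamma.
have [kras_ex kras_max] := krasP nubar Kbar_closure a_separable a_notin_K.
have algKx := algebraic_over_rational_functions Kbar_closure Omega_closure.
pose Ka := adjoin (range iota) a.
have K_Ka : range iota `<=` Ka by exact: sub_adjoin.
have Ka_a : Ka a by exact: mem_adjoin.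
split=> [IC|kras_gamma].
- rewrite oag_ltNge; apply/negP => gamma_kras.
  have [p pa psep] := a_separable.
  (* Only the image of [a] has to be kept: in the henselian case [s] itself is isometric, in rank
     one it is replaced by an isometry with the same effect on [a]. *)
  have isometric_conj s : in_galois iota s ->
      exists t : {rmorphism Kbar -> Kbar}, [/\ forall c, t (iota c) = iota c,
        t a = s a & forall z, nubar (t z) = nubar z].
    move=> [_ si]; case: hensel_or_rank_one => [henK|rank1].
      by exists s; split=> // z; exact: henselian_invariant henK si z.
    have gamma_bound : exists2 h, value_group nu h & gamma <= h.
      have [y yg] := gamma_val.
      have [|c [h [ch c0 gh]]] := @value_bounded_by_base _ _ _ _ W (j y) gamma (algKx (j y)).
        by rewrite W_omegabar.
      have [|h' nuh' hh'] := nu_cofinal h.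
        by exists c; rewrite -omegabar_omega -W_omegabar.
      by exists h' => //; exact: le_trans gh hh'.
    have rsa : root (map_poly iota p) (s a) by apply: fixed_root si _ _ _; case: pa.
    exact: (rank_one_conjugate Kbar_closure nubar_nu rank1 gamma_bound a_min pa psep a_notin_K rsa).
  have [s [t [sG tG st]]] := kras_ex.
  have [s' [s'K s'a s'nu]] := isometric_conj s sG.
  have [t' [t'K t'a t'nu]] := isometric_conj t tG.
  have [s'V s'VK VKs'] := algebraic_endo_bij Kbar_closure s'K.
  (* The intended map is [t'] followed by the inverse of [s']; it moves [a] by exactly [kras]. As
     [s'V] is a bare function, the ring morphism is rebuilt by extending the isometry that sends [a]
     to [b]. *)
  pose b := s'V (t' a).
  have s'b : s' b = t' a by exact: VKs'.
  have [u [uK ua unu]] : exists u : {rmorphism Kbar -> Kbar},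
      [/\ forall c, u (iota c) = iota c, u a = b & forall z, nubar (u z) = nubar z].
    apply: (isometric_extension_root Kbar_closure pa) => q.
    rewrite -(s'nu (map_poly iota q).[b]) -horner_map (map_fixed_poly s'K) /= s'b.
    by rewrite -(t'nu (map_poly iota q).[a]) -[in LHS]horner_map (map_fixed_poly t'K).
  have ab : nubar (a - u a) = Some (kras iota nubar a).
    by rewrite ua -s'nu rmorphB s'b s'a t'a.
  have aIC : implicit_constant_field iota j W a.
    by rewrite IC; apply: sub_henselization.
  have ua_a : u a = a.
    apply: (implicit_constant_fixed Kbar_closure Omega_closure omegabar_nubar
      W_omegabar a_mon uK unu _ aIC).
    by rewrite ab.
  by rewrite ua_a subrr vfun0 in ab.
- apply/seteqP; split=> z.
    move=> zIC H [sH KaH hH].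
    apply: (implicit_constant_sub Kbar_closure Omega_closure omegabar_nubar
      W_omegabar a_mon sH _ _ hH zIC); last exact: KaH.
    exact: subset_trans K_Ka KaH.
  move=> zKa H [sH KxH hH].
  (* The constants of [H] form a henselian subfield of Kbar containing K(a), so they are among the
     fields whose intersection is K(a)^h. *)
  apply: (zKa [set y | H (j (frac_const y))]); split.
  + exact: subfield_constants sH.
  + apply: adjoin_min; first exact: subfield_constants sH.
      exact: base_constants KxH.
    exact: (krasner_constants Kbar_closure Omega_closure omegabar_nubar W_omegabar
      sH KxH hH a_mon a_separable a_notin_K kras_gamma).
  + exact: (henselian_constants Kbar_closure Omega_closure omegabar_nubar W_omegabar
      sH KxH hH).
Qed.
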